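(* Suppose that assumptions (A)–(E) below hold. Then \begin{align*} \sup_{\lambda^\star\in\Lambda_n^\star}\mathsf{P}_{\lambda^\star}^{(n)}\Big[\hat\Xi_n\big(d_n(T_n(\theta),\lambda^\star)\ge A_n\sqrt{L_n}\,\epsilon_{n}\big)\Big]=o(1) \end{align*} for any diverging sequence $A_n\to\infty$.
   Context: Setting: for each $n$, $Y^{(n)}\in\mathfrak{Y}_n$ ($\sigma$-finite $\mu_n$), natural parameter space $\Lambda_n$ with metric $d_n$, likelihood $q_n:\Lambda_n\times\mathfrak{Y}_n\to(0,\infty)$, $\mathsf{P}^{(n)}_\lambda(dy)=q_n(\lambda,y)\mu_n(dy)$. Countable model index set $\mathcal{M}_n$, parameter spaces $\Theta_{n,m}$, $\Theta_{n,\mathcal{M}_n}=\cup_m\Theta_{n,m}$, map $T_n:\Theta_{n,\mathcal{M}_n}\to\Lambda_n$. Prior $\Pi_n=\sum_m\alpha_{n,m}\Pi_{n,m}$, $\Pi_{n,m}\in\mathbb{P}(\Theta_{n,m})$, posterior $\Pi_n(\cdot\mid Y^{(n)})\propto q_n(T_n(\theta),Y^{(n)})\Pi_n(d\theta)$. Variational family $\mathbb{V}_n=\{\sum_m\gamma_m\Xi_m:(\gamma_m)\text{ probability vector},\ \Xi_m\in\mathbb{V}_{n,m}\}$ with $\mathbb{V}_{n,m}\subset\mathbb{P}(\Theta_{n,m})$, and $\hat\Xi_n\in\arg\min_{\Xi\in\mathbb{V}_n}\mathrm{KL}(\Xi,\Pi_n(\cdot\mid Y^{(n)}))$. $\mathsf{D}_\rho(\mathsf{P}_1,\mathsf{P}_2)=\frac{1}{\rho-1}\log\int(d\mathsf{P}_1/d\mathsf{P}_2)^{\rho-1}d\mathsf{P}_1$;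 $\mathcal{N}(u,S,d_n)$ is the $u$-covering number of $S$ w.r.t. $(\theta,\theta')\mapsto d_n(T_n(\theta),T_n(\theta'))$. (A) Constants $\rho_\circ\in(0,1)$, $\rho_{+}>1$, $a_2\ge a_1$, $c_2\ge c_1>0$ with $a_1+c_1nd_n^2(\lambda_0,\lambda_1)\le\mathsf{D}_{\rho_\circ}(\mathsf{P}^{(n)}_{\lambda_0},\mathsf{P}^{(n)}_{\lambda_1})$ and $\mathsf{D}_{\rho_{+}}(\mathsf{P}^{(n)}_{\lambda_0},\mathsf{P}^{(n)}_{\lambda_1})\le a_2+c_2nd_n^2(\lambda_0,\lambda_1)$ for all $\lambda_0,\lambda_1\in\Lambda_n$, large $n$. (B) For true spaces $\Lambda_n^\star\subset\Lambda_n$ there are positive $\eta_{n,m},\zeta_{n,m}$: for every $\lambda^\star\in\Lambda_n^\star$, $m$, some $\theta^*_{n,m}(\lambda^\star)\in\Theta_{n,m}$ has $d_n(T_n(\theta^*_{n,m}(\lambda^\star)),\lambda^\star)\le\eta_{n,m}$; and for each $u>0$ some $c(u)$ gives $\sup_{\zeta>\zeta_{n,m}}\log\mathcal{N}(u\zeta,\{\theta\in\Theta_{n,m}:d_n(T_n(\theta),\lambda^\star)\le2\zeta\},d_n)\le c(u)n\zeta_{n,m}^2$ for all $\lambda^\star\in\Lambda_n^\star$, $m$, large $n$. (C) $\epsilon_n:=\inf_m(\eta_{n,m}+\zeta_{n,m})$ satisfies $n\epsilon_n^2\to\infty$, and constants $c_1,c_2,c_3>0$ give $\sum_{m:\zeta_{n,m}\ge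 H'\epsilon_n}e^{-L'n\zeta_{n,m}^2}\le e^{(c_1-L'(H')^2)n\epsilon_n^2}$ and $\sum_{m:\zeta_{n,m}<H'\epsilon_n}e^{L''n\zeta_{n,m}^2}\le e^{(c_2+c_3L''(H')^2)n\epsilon_n^2}$ for large $n$, all $H'>1$, $L',L''>0$. (D) $\alpha_{n,m}\propto e^{-b_0L_nn\zeta_{n,m}^2}$ ($b_0>0$, $L_n\ge1$); some $c>0$ gives $\Pi_{n,m}(d_n(T_n(\theta),\lambda^\star)\le\eta_{n,m}+\zeta_{n,m})\ge e^{-cn\zeta_{n,m}^2}$ for all $\lambda^\star\in\Lambda_n^\star$, $m$, large $n$; $\Pi_n$ is independent of $Y^{(n)}$. (E) Some $c>0$ gives $\sup_{\lambda^\star\in\Lambda_n^\star}\mathsf{P}^{(n)}_{\lambda^\star}[\inf_{\Xi\in\mathbb{V}_n}\mathrm{KL}(\Xi,\Pi_n(\cdot\mid Y^{(n)}))]\le cL_nn\epsilon_n^2$ for large $n$. *)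

(* Defs.v *)
From Stdlib Require Import List.
From HB Require Import structures.
From mathcomp Require Import all_boot all_order all_algebra.
From mathcomp Require Import all_classical all_reals all_analysis measurable_realfun.
Set Implicit Arguments.
Unset Strict Implicit.
Unset Printing Implicit Defensive.
Import Order.TTheory GRing.Theory Num.Theory.
Local Open Scope classical_set_scope.
Local Open Scope ring_scope.

Definition is_metric (R : realType) (L : Type) (dist : L -> L -> R) : Prop :=
  [/\ forall x y, 0 <= dist x y,
      forall x y, dist x y = 0 <-> x = y,
      forall x y, dist x y = dist y x &
      forall x y z, dist x z <= dist x y + dist y z].

Definition is_pos_density d (Y : measurableType d) (R : realType)
  (mu : {measure set Y -> \bar R}) (f : Y -> R) : Prop :=
  [/\ measurable_fun setT f, forall y, 0 < f y &
      (\int[mu]_y (f y)%:E = 1)%E].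

Definition expect d (Y : measurableType d) (R : realType)
  (mu : {measure set Y -> \bar R}) (dens : Y -> R) (f : Y -> \bar R) : \bar R :=
  (\int[mu]_y (f y * (dens y)%:E))%E.

(* Renyi divergence D_rho(P1,P2) = 1/(rho-1) log \int (dP1/dP2)^(rho-1) dP1,
   where P_i(dy) = q_i(y) mu(dy) with q_i > 0 (so dP1/dP2 = q1/q2).
   An infinite integral gives +oo. *)
Definition renyi d (Y : measurableType d) (R : realType)
  (mu : {measure set Y -> \bar R}) (rho : R) (q1 q2 : Y -> R) : \bar R :=
  match (\int[mu]_y (((q1 y / q2 y) `^ (rho - 1)) * q1 y)%:E)%E with
  | r%:E => ((rho - 1)^-1 * ln r)%:E
  | _ => +oo%E
  end.

(* Kullback-Leibler divergence KL(P,Q) = \int f log f dQ with f = dP/dQ when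
   P << Q (i.e. P has a density w.r.t. Q), and +oo otherwise. *)
Definition rn_densities d (T : measurableType d) (R : realType)
  (P Q : probability T R) : set (T -> R) :=
  [set f : T -> R | [/\ measurable_fun setT f, forall x, 0 <= f x &
     forall A, measurable A -> P A = (\int[Q]_(x in A) (f x)%:E)%E]].

Definition KL d (T : measurableType d) (R : realType)
  (P Q : probability T R) : \bar R :=
  if pselect (rn_densities P Q !=set0) is left _ then
    let f := xget (fun=> 0) (rn_densities P Q) in
    (\int[Q]_x (f x * ln (f x))%:E)%E
  else +oo%E.

Definition probvec (R : realType) (M : countType) (g : M -> R) : Prop :=
  (forall m, 0 <= g m) /\ (\esum_(m in [set: M]) (g m)%:E = 1)%E.

Definition is_mixture d (T : measurableType d) (R : realType) (M : countType)
  (Xi : probability T R) (g : M -> R) (Xis : M -> probability T R) : Prop :=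
  forall A, measurable A ->
    Xi A = (\esum_(m in [set: M]) ((g m)%:E * Xis m A))%E.

Definition in_mixture_family d (T : measurableType d) (R : realType) (M : countType)
  (V : M -> set (probability T R)) (Xi : probability T R) : Prop :=
  exists (g : M -> R) (Xis : M -> probability T R),
    [/\ probvec g, forall m, V m (Xis m) & is_mixture Xi g Xis].

(* u-covering of S by closed balls (for the pseudo-metric (t,t') |-> dist (T t) (T t'))
   with centers in S; the covering number is the least size of such a cover (+oo if none) *)
Definition is_cover (R : realType) (Th L : Type) (dist : L -> L -> R) (T : Th -> L)
  (u : R) (S : set Th) (c : seq Th) : Prop :=
  (forall t, In t c -> S t) /\
  (forall t, S t -> exists2 t', In t' c & dist (T t) (T t') <= u).

Definition covering_number (R : realType) (Th L : Type) (dist : L -> L -> R)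
  (T : Th -> L) (u : R) (S : set Th) : \bar R :=
  ereal_inf [set ((size c)%:R)%:E | c in is_cover dist T u S].

Definition log_covering_number (R : realType) (Th L : Type) (dist : L -> L -> R)
  (T : Th -> L) (u : R) (S : set Th) : \bar R :=
  match covering_number dist T u S with
  | r%:E => if r == 0 then -oo%E else (ln r)%:E
  | +oo%E => +oo%E
  | -oo%E => -oo%E
  end.

Definition min_rate (R : realType) (M : countType) (eta zeta : M -> R) : R :=
  inf [set eta m + zeta m | m in [set: M]].

(* Main.v *)
Require Import Defs.
From HB Require Import structures.
From mathcomp Require Import all_boot all_order all_algebra.
From mathcomp Require Import all_classical all_reals all_analysis measurable_realfun.
From mathcomp Require Import ring lra.
Import Order.TTheory GRing.Theory Num.Theory.
Local Open Scope classical_set_scope.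
Local Open Scope ring_scope.

(**
Let E = n eps_n^2, r = A_n sqrt(L_n) eps_n, X = n r^2 and let U be the set of theta at
distance at least r from the truth.  The Donsker-Varadhan inequality gives
s Xihat(U) <= KL(Xihat, post) + e^s post(U) for every s >= 0, and
KL(Xihat, post) is the infimum controlled by (E).  With s of order X, it remains to
bound post(U) by e^{-gX} outside an event of small probability:
- the evidence is at least of order e^{-C L_n E}: the rho_+ divergence in (A) controls it
  on the ball of radius 2 eps_n, whose prior mass is bounded below through a model
  almost minimizing eta + zeta;
- models with zeta >= h A_n eps_n have prior mass at most e^{C L_n E - b_0 h^2 X};
- for the other models, U is cut into the shells j r <= d < (j+1) r and each shell is
  covered by balls of radius u j r.  The likelihood ratio tests of the truth against the
  centres have small errors by the rho_o divergence in (A), and the rho_+ divergence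
  carries the second kind of error from a centre to its ball.
*)

(** * Likelihood ratio tests and change of measure *)

(* Splitting at the level a / b = K serves as a substitute for Hoelder's inequality
   in the change of measure and for Jensen's inequality in the evidence bound. *)
Lemma le_powR_tilt {R : realType} (a b K rho : R) :
  0 < a -> 0 < b -> 0 < K -> 1 < rho ->
  a <= K * b + K `^ (1 - rho) * ((a / b) `^ (rho - 1) * a).
Proof.
move=> a0 b0 K0 rho1.
have [aKb|Kba] := leP a (K * b).
  by rewrite (le_trans aKb)// lerDl !mulr_ge0 ?powR_ge0 ?ltW.
have Kab : K <= a / b by rewrite ler_pdivlMr// ltW.
apply: (@le_trans _ _ (K `^ (1 - rho) * (K `^ (rho - 1) * a))); last first.
  rewrite (@le_trans _ _ (K `^ (1 - rho) * ((a / b) `^ (rho - 1) * a)))//; last first.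
    by rewrite lerDr mulr_ge0 ?ltW.
  rewrite ler_wpM2l ?powR_ge0// ler_wpM2r ?(ltW a0)//.
  apply: ge0_ler_powR; rewrite ?nnegrE ?subr_ge0 ?divr_ge0 ?(ltW a0) ?(ltW b0) ?(ltW K0)//.
  exact: ltW.
rewrite mulrA -powRD ?(gt_eqF K0) ?implybT// (_ : 1 - rho + (rho - 1) = 0); last by ring.
by rewrite powRr0 mul1r.
Qed.

(** The tilt is a^rho b^(1 - rho), so for 0 < rho < 1 it lies between the smaller of [a] and [b] and
    their sum. The lower bounds serve the test errors, the upper one the finiteness of the affinity
    integral. *)
Lemma powR_tilt_ge_left {R : realType} (a b rho : R) :
  0 < a -> 0 < b -> rho < 1 -> a <= b -> a <= (a / b) `^ (rho - 1) * a.
Proof.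
move=> a0 b0 rho1 ab; rewrite ler_peMl ?(ltW a0)//.
rewrite -[leLHS](powRr0 (a / b)); apply: ger_powR.
  by rewrite divr_gt0 ?ler_pdivrMr ?mul1r.
by rewrite subr_le0 ltW.
Qed.

Lemma powR_tilt_ge_right {R : realType} (a b rho : R) :
  0 < a -> 0 < b -> 0 < rho -> b <= a -> b <= (a / b) `^ (rho - 1) * a.
Proof.
move=> a0 b0 rho0 ba; apply: (@le_trans _ _ ((a / b) `^ (-1) * a)).
  by rewrite powR_inv1 ?divr_ge0 ?(ltW a0) ?(ltW b0)// invf_div divfK ?gt_eqF.
rewrite ler_wpM2r ?(ltW a0)//; apply: ler_powR; first by rewrite ler_pdivlMr ?mul1r.
lra.
Qed.

Lemma powR_tilt_le_add {R : realType} (a b rho : R) :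
  0 < a -> 0 < b -> 0 < rho < 1 -> (a / b) `^ (rho - 1) * a <= a + b.
Proof.
move=> a0 b0 /andP[rho0 rho1]; have [ab|ba] := leP a b.
  apply: (@le_trans _ _ ((a / b) `^ (-1) * a)); last first.
    by rewrite powR_inv1 ?divr_ge0 ?(ltW a0) ?(ltW b0)// invf_div divfK ?gt_eqF// lerDr ltW.
  rewrite ler_wpM2r ?(ltW a0)//; apply: ger_powR.
    by rewrite divr_gt0 ?ler_pdivrMr ?mul1r.
  by rewrite lerBrDr addNr ltW.
apply: (@le_trans _ _ (1 * a)); last by rewrite mul1r lerDl ltW.
rewrite ler_wpM2r ?(ltW a0)// -[leRHS](powRr0 (a / b)); apply: ler_powR.
  by rewrite ler_pdivlMr ?mul1r ?(ltW ba).
by rewrite subr_le0 ltW.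
Qed.

Lemma measurable_tilt d {Y : measurableType d} {R : realType} (p q : Y -> R) (r : R) :
  (forall y, 0 < q y) -> measurable_fun setT p -> measurable_fun setT q ->
  measurable_fun setT (fun y => (p y / q y) `^ r * p y).
Proof.
move=> q0 mp mq; apply: measurable_funM => //.
apply: (measurableT_comp (measurable_powR r)); apply: measurable_funM => //.
apply: (eq_measurable_fun (fun y => q y `^ (-1))).
  by move=> y _; rewrite powR_inv1// ltW.
exact: (measurableT_comp (measurable_powR (-1))).
Qed.

Lemma renyi_le_integral d {Y : measurableType d} {R : realType}
    (mu : {measure set Y -> \bar R}) (rho w : R) (p q : Y -> R) :
  1 < rho -> (forall y, 0 < p y) ->
  (renyi mu rho p q <= w%:E)%E ->
  (\int[mu]_y ((p y / q y) `^ (rho - 1) * p y)%:E <= (expR ((rho - 1) * w))%:E)%E.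
Proof.
move=> rho1 p0; rewrite /renyi; have rho10 : 0 < rho - 1 by rewrite subr_gt0.
have : (0 <= \int[mu]_y ((p y / q y) `^ (rho - 1) * p y)%:E)%E.
  by apply: integral_ge0 => y _; rewrite lee_fin mulr_ge0 ?powR_ge0 ?ltW.
case: integral => [r|//|//]; rewrite !lee_fin => r0 rw.
(* At a nonpositive [r] the value of [ln] carries no information, but the bound is then trivial. *)
have [r_gt0|] := ltP 0 r; last by move=> /le_trans; apply; exact: expR_ge0.
rewrite -[leLHS](lnK r_gt0) ler_expR.
by rewrite -ler_pdivrMl.
Qed.

(** As rho - 1 < 0, a lower bound on the divergence is an upper bound on the affinity integral. The
    value +oo that [renyi] gives to an infinite integral would satisfy every lower bound, so the
    integral is first shown to be at most 2, the total mass of p + q. *)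
Lemma renyi_ge_integral d {Y : measurableType d} {R : realType}
    (mu : {measure set Y -> \bar R}) (rho v : R) (p q : Y -> R) :
  0 < rho < 1 -> is_pos_density mu p -> is_pos_density mu q ->
  (v%:E <= renyi mu rho p q)%E ->
  (\int[mu]_y ((p y / q y) `^ (rho - 1) * p y)%:E <= (expR (- ((1 - rho) * v)))%:E)%E.
Proof.
move=> rho01 [mp p0 ip] [mq q0 iq]; rewrite /renyi.
have rho10 : 0 < 1 - rho by move: rho01; lra.
have : (0 <= \int[mu]_y ((p y / q y) `^ (rho - 1) * p y)%:E)%E.
  by apply: integral_ge0 => y _; rewrite lee_fin mulr_ge0 ?powR_ge0 ?ltW.
have : (\int[mu]_y ((p y / q y) `^ (rho - 1) * p y)%:E <= 2%:E)%E.
  have -> : 2%:E = (\int[mu]_y ((p y)%:E + (q y)%:E))%E :> \bar R.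
    rewrite ge0_integralD// ?ip ?iq//.
    - by move=> y _; rewrite lee_fin ltW.
    - exact/measurable_EFinP.
    - by move=> y _; rewrite lee_fin ltW.
    - exact/measurable_EFinP.
  apply: ge0_le_integral => //.
  - by move=> y _; rewrite lee_fin mulr_ge0 ?powR_ge0 ?ltW.
  - by apply/measurable_EFinP; exact: measurable_tilt.
  - by apply: emeasurable_funD; exact/measurable_EFinP.
  - by move=> y _; rewrite -EFinD lee_fin powR_tilt_le_add.
case: integral => [r|//|//]; rewrite !lee_fin => _ r0 vr.
have [r_gt0|] := ltP 0 r; last by move=> /le_trans; apply; exact: expR_ge0.
rewrite -[leLHS](lnK r_gt0) ler_expR -mulrN mulrC -ler_pdivrMr//.
rewrite (_ : ln r / (1 - rho) = - ((rho - 1)^-1 * ln r)) ?lerN2//.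
by rewrite -[1 - rho]opprB invrN mulrN mulrC.
Qed.

(** Each error integrates the smaller of the two densities over its region, and the tilt dominates
    that one; a single affinity integral thus bounds both. *)
Lemma likelihood_test_errors d {Y : measurableType d} {R : realType}
    (mu : {measure set Y -> \bar R}) (rho v : R) (p q : Y -> R) :
  0 < rho < 1 -> is_pos_density mu p -> is_pos_density mu q ->
  (v%:E <= renyi mu rho p q)%E ->
  (\int[mu]_(y in [set y | (p y <= q y)%R]) (p y)%:E <= (expR (- ((1 - rho) * v)))%:E)%E /\
  (\int[mu]_(y in ~` [set y | (p y <= q y)%R]) (q y)%:E <= (expR (- ((1 - rho) * v)))%:E)%E.
Proof.
move=> rho01 dp dq vr; have := dp => -[mp p0 _]; have := dq => -[mq q0 _].
have mD : measurable [set y | (p y <= q y)%R].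
  by rewrite -[X in measurable X]setTI; exact: measurable_fun_le.
have tilt0 y : (0 <= ((p y / q y) `^ (rho - 1) * p y)%:E)%E.
  by rewrite lee_fin mulr_ge0 ?powR_ge0 ?ltW.
have mt := measurable_tilt _ p q (rho - 1) q0 mp mq.
have main (D : set Y) (f : Y -> R) : measurable D -> measurable_fun setT f ->
    (forall y, 0 < f y) -> (forall y, D y -> f y <= (p y / q y) `^ (rho - 1) * p y) ->
    (\int[mu]_(y in D) (f y)%:E <= (expR (- ((1 - rho) * v)))%:E)%E.
  move=> mD' mf f0 fle; apply: le_trans (renyi_ge_integral _ _ _ _ _ _ rho01 dp dq vr).
  apply: (@le_trans _ _ (\int[mu]_(y in D) ((p y / q y) `^ (rho - 1) * p y)%:E)%E).
    apply: ge0_le_integral => //.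
    - by move=> y _; rewrite lee_fin ltW.
    - by apply/measurable_EFinP; exact: measurable_funTS.
    - by apply/measurable_EFinP; exact: measurable_funTS.
  by apply: ge0_subset_integral => //; exact/measurable_EFinP.
have /andP[rho0 rho1] := rho01.
split; apply: main => //.
- by move=> y /=; exact: powR_tilt_ge_left.
- exact: measurableC.
- by move=> y /= /negP; rewrite -ltNge => /ltW; exact: powR_tilt_ge_right.
Qed.

(** Integration of [le_powR_tilt] over [A]. The level [K] stays free: raising it shrinks the tilted
    remainder and enlarges the factor of the [q]-mass. *)
Lemma renyi_change_of_measure d {Y : measurableType d} {R : realType}
    (mu : {measure set Y -> \bar R}) (rho w K : R) (p q : Y -> R) (A : set Y) :
  1 < rho -> 0 < K -> measurable A ->
  is_pos_density mu p -> is_pos_density mu q ->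
  (renyi mu rho p q <= w%:E)%E ->
  (\int[mu]_(y in A) (p y)%:E <= K%:E * \int[mu]_(y in A) (q y)%:E
     + (K `^ (1 - rho) * expR ((rho - 1) * w))%:E)%E.
Proof.
move=> rho1 K0 mA [mp p0 ip] [mq q0 iq] rw.
have tilt0 y : (0 <= ((p y / q y) `^ (rho - 1) * p y)%:E)%E.
  by rewrite lee_fin mulr_ge0 ?powR_ge0 ?ltW.
have mt := measurable_tilt _ p q (rho - 1) q0 mp mq.
have mt' : measurable_fun A (fun y => ((p y / q y) `^ (rho - 1) * p y)%:E).
  by apply/measurable_EFinP; exact: measurable_funTS.
have mq' : measurable_fun A (EFin \o q).
  by apply/measurable_EFinP; exact: measurable_funTS.
have mp' : measurable_fun A (EFin \o p).
  by apply/measurable_EFinP; exact: measurable_funTS.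
apply: (@le_trans _ _ (\int[mu]_(y in A) (K%:E * (q y)%:E +
    (K `^ (1 - rho))%:E * ((p y / q y) `^ (rho - 1) * p y)%:E))%E).
  apply: ge0_le_integral => //.
  - by move=> y _; rewrite lee_fin ltW.
  - apply: emeasurable_funD; exact: measurable_funeM.
  - by move=> y _; rewrite -!EFinM -EFinD lee_fin; exact: le_powR_tilt.
rewrite ge0_integralD//.
- rewrite ge0_integralZl_EFin ?(ltW K0)//; last by move=> y _; rewrite lee_fin ltW.
  rewrite ge0_integralZl_EFin ?powR_ge0// EFinM.
  apply: leeD => //; apply: lee_wpmul2l; first by rewrite lee_fin powR_ge0.
  apply: le_trans (renyi_le_integral _ _ _ _ _ _ rho1 p0 rw).
  by apply: ge0_subset_integral => //; exact/measurable_EFinP.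
- by move=> y _; rewrite -EFinM lee_fin mulr_ge0// ltW.
- exact: measurable_funeM.
- by move=> y _; rewrite mule_ge0// lee_fin powR_ge0.
- exact: measurable_funeM.
Qed.

(** * Variational inequality, evidence and posterior mass *)

(** The Fenchel-Young inequality for f ln f - f, whose conjugate is exp; it is 1 + x <= e^x at x = v
    - ln f. *)
Lemma fenchel_xlnx {R : realType} (f v : R) : 0 <= f -> f * v <= f * ln f - f + expR v.
Proof.
rewrite le_eqVlt => /predU1P[<-|f0]; first by rewrite !mul0r subr0 add0r expR_ge0.
have : f * (1 + (v - ln f)) <= f * expR (v - ln f).
  by rewrite ler_wpM2l ?(ltW f0)// expR_ge1Dx.
rewrite expRB (lnK f0) [f * (expR v / f)]mulrCA divff ?gt_eqF// mulr1; lra.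
Qed.

Lemma xlnx_ge {R : realType} (f : R) : 0 <= f -> -1 <= f * ln f.
Proof. by move=> f0; have := fenchel_xlnx f 0 f0; rewrite mulr0 expR0; lra. Qed.

(** The integral of [g] may be +oo. Its negative part has integral at most 1, hence finite, and can
    be moved across the identity g^+ + 1 = (g + 1) + g^-, all of whose terms are nonnegative. *)
Lemma integral_add1 d {T : measurableType d} {R : realType} (Q : probability T R)
    (g : T -> R) : measurable_fun setT g -> (forall x, -1 <= g x) ->
  (\int[Q]_x (g x + 1)%:E = \int[Q]_x (g x)%:E + 1)%E.
Proof.
move=> mg g1; have mge : measurable_fun setT (EFin \o g) by exact/measurable_EFinP.
have mp := measurable_funepos mge; have mn := measurable_funeneg mge.
have i1 : (\int[Q]_x (cst 1 x) = 1 :> \bar R)%E.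
  by rewrite integral_cst// mul1e; exact: probability_setT.
have n1 : (\int[Q]_x ((EFin \o g)^\- x) <= 1)%E.
  rewrite -i1; apply: ge0_le_integral => // x _.
  by rewrite unlock /= ge_max lee_fin lee01 andbT lerNl.
have nfin : (\int[Q]_x ((EFin \o g)^\- x))%E \is a fin_num.
  rewrite ge0_fin_numE; first exact: le_lt_trans n1 (ltry _).
  by apply: integral_ge0 => x _; exact: funeneg_ge0.
have : (\int[Q]_x ((EFin \o g)^\+ x + cst 1 x) =
        \int[Q]_x ((g x + 1)%:E + (EFin \o g)^\- x))%E.
  apply: eq_integral => x _; rewrite !unlock /= /maxe !lte_fin.
  rewrite oppr_lt0.
  by case: (ltgtP (g x) 0) => [gx|gx|->]; rewrite -!EFinD; apply/eqP; rewrite eqe; apply/eqP; lra.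
rewrite ge0_integralD//.
rewrite ge0_integralD//; last 2 first.
- by move=> x _; rewrite lee_fin -lerBlDr sub0r.
- by apply/measurable_EFinP; exact: measurable_funD.
rewrite i1 => h.
rewrite [in RHS]integralE addeAC h addeK//.
Qed.


(** [fenchel_xlnx] is applied to the density with v = s on [U] and v = 0 elsewhere, then integrated
    against [Q]. Without a density, [KL] is +oo and nothing is left to prove. *)
Lemma donsker_varadhan_set d {T : measurableType d} {R : realType}
    (P Q : probability T R) (s : R) (U : set T) : 0 <= s -> measurable U ->
  (s%:E * P U <= KL P Q + (expR s)%:E * Q U)%E.
Proof.
move=> s0 mU; rewrite /KL; case: pselect => [ex|_]; last first.
  rewrite addye ?leey// gt_eqF//; apply: (@lt_le_trans _ _ 0%E) => //.
  by rewrite mule_ge0// lee_fin expR_ge0.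
set f := xget _ _; have [mf f0 fP] : rn_densities P Q f by exact: xgetPex.
have mfe : measurable_fun setT (EFin \o f) by exact/measurable_EFinP.
have mg : measurable_fun setT (fun x => f x * ln (f x)).
  by apply: measurable_funM => //; exact: measurableT_comp.
have mU' : measurable_fun setT (EFin \o (\1_U : T -> R)).
  by apply/measurable_EFinP; exact: measurable_indic.
have fi : (\int[Q]_x (f x)%:E = 1)%E by rewrite -fP// probability_setT.
have fU : (\int[Q]_x ((s * \1_U x)%:E * (f x)%:E) = s%:E * P U)%E.
  under eq_integral => x _ do rewrite EFinM -muleA [X in (_ * X)%E]muleC.
  rewrite ge0_integralZl_EFin//; last 2 first.
  - by move=> x _; rewrite -EFinM lee_fin mulr_ge0.
  - exact: emeasurable_funM.
  by rewrite fP// [in RHS]integral_mkcond epatch_indic.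
(* Adding [f] on the left and 1 on the right makes both integrands nonnegative, so an infinite
   divergence is allowed; the two added integrals both equal 1 and cancel. *)
have : (\int[Q]_x ((s * \1_U x)%:E * (f x)%:E + (f x)%:E) <=
    \int[Q]_x ((f x * ln (f x) + 1)%:E + (expR s)%:E * (\1_U x)%:E))%E.
  apply: ge0_le_integral => //.
  - by move=> x _; rewrite -EFinM -EFinD lee_fin addr_ge0// !mulr_ge0.
  - apply: emeasurable_funD => //; apply: emeasurable_funM => //.
    by apply/measurable_EFinP; apply: measurable_funM => //; exact: measurable_indic.
  - apply: emeasurable_funD; last exact: measurable_funeM.
    by apply/measurable_EFinP; exact: measurable_funD.
  - move=> x _; rewrite -!EFinM -!EFinD lee_fin indicE.
    case: (x \in U); rewrite ?mulr1n ?mulr0n ?mulr1 ?mulr0 ?mul0r.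
      by have := fenchel_xlnx (f x) s (f0 x); lra.
    by have := fenchel_xlnx (f x) 0 (f0 x); rewrite mulr0 expR0; lra.
rewrite ge0_integralD//; last 3 first.
- by move=> x _; rewrite -EFinM lee_fin !mulr_ge0.
- apply: emeasurable_funM => //.
  by apply/measurable_EFinP; apply: measurable_funM => //; exact: measurable_indic.
- by move=> x _; rewrite lee_fin.
rewrite ge0_integralD//; last 3 first.
- by move=> x _; rewrite lee_fin -lerBlDr sub0r; exact: xlnx_ge.
- by apply/measurable_EFinP; exact: measurable_funD.
- exact: measurable_funeM.
rewrite fU fi integral_add1//; last by move=> x; exact: xlnx_ge.
rewrite ge0_integralZl_EFin ?expR_ge0// integral_indic// setIT addeAC leeD2rE//.
Qed.

Lemma KL_ge0 d {T : measurableType d} {R : realType} (P Q : probability T R) :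
  (0 <= KL P Q)%E.
Proof.
have := donsker_varadhan_set _ P Q 0 set0 (lexx 0) measurable0.
by rewrite !measure0 !mule0 adde0.
Qed.

(* The factor 2 avoids having to attain the infimum defining the covering number,
   and covers the empty set, whose log covering number is -oo. *)
Lemma exists_cover_of_log {R : realType} {Th L : Type} (dist : L -> L -> R)
    (T : Th -> L) (u : R) (S : set Th) (x : R) :
  (log_covering_number dist T u S <= x%:E)%E ->
  exists2 c : seq Th, is_cover dist T u S c & (size c)%:R <= 2 * expR x.
Proof.
move=> h; have : (covering_number dist T u S < (2 * expR x)%:E)%E.
  move: h; rewrite /log_covering_number; case: covering_number => [r| |] //=.
    have [->|r0] := eqVneq r 0; first by rewrite lte_fin mulr_gt0 ?expR_gt0.
    rewrite lee_fin lte_fin => lrx; have [rp|rn] := ltP 0 r; last first.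
      by rewrite (le_lt_trans rn)// mulr_gt0 ?expR_gt0.
    have : r <= expR x by rewrite -[leLHS](lnK rp) ler_expR.
    by have := expR_gt0 x; lra.
  by rewrite ltNyr.
by move=> /ereal_inf_lt[_ [c hc <-]]; rewrite lte_fin => /ltW cx; exists c.
Qed.

(** Sigma-subadditivity is transported to [nat] along [pickle]; integers that code no element of [D]
    receive the empty set. *)
Lemma measure_le_esum_bigcup d {T : measurableType d} {R : realType} {I : countType}
    (mu : {measure set T -> \bar R}) (D : set I) (F : I -> set T) (A : set T) :
  measurable A -> (forall i, D i -> measurable (F i)) -> A `<=` \bigcup_(i in D) F i ->
  (mu A <= \esum_(i in D) mu (F i))%E.
Proof.
move=> mA mF AF.
pose G (k : nat) : set T :=
  if @pickle_inv I k is Some i then (if i \in D then F i else set0) else set0.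
have mG k : measurable (G k).
  rewrite /G; case: pickle_inv => // i; case: ifPn => //; rewrite inE; exact: mF.
have GE i : D i -> G (pickle i) = F i by move=> Di; rewrite /G pickleK_inv ifT// inE.
apply: (@le_trans _ _ (\sum_(0 <= k <oo) mu (G k))%E).
  apply: measure_sigma_subadditive => // x /AF[i Di Fx].
  by exists (pickle i) => //; rewrite GE.
rewrite nneseries_esumT//.
under [leRHS]eq_esum => i Di do rewrite -(GE i Di).
rewrite -(esum_image D pickle (mu \o G)); last first.
  by move=> i j _ _ /(pcan_inj pickleK).
rewrite [leRHS]esum_mkcond; apply: le_esum => k _; case: ifPn => // kD.
suff -> : G k = set0 by rewrite measure0.
rewrite /G; case E : pickle_inv => [i|//]; case: ifPn => // iD.
move: kD; rewrite notin_setE/=; case; exists i; first by rewrite inE in iD.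
by have := @pickle_invK I k; rewrite E.
Qed.

Lemma le_esumZl {R : realType} {I : choiceType} (D : set I) (k : R) (a : I -> \bar R) :
  0 <= k -> (forall i, 0 <= a i)%E ->
  (\esum_(i in D) (k%:E * a i) <= k%:E * \esum_(i in D) a i)%E.
Proof.
move=> k0 a0; apply: ge_ereal_sup => _ [X [finX XD] <-].
rewrite fsbig_finite//= -ge0_sume_distrr//.
  apply: lee_wpmul2l; first by rewrite lee_fin.
  by apply: ereal_sup_ubound; exists X => //; rewrite fsbig_finite.
Qed.

(** The property [sigma_finite] is packed into a structure on [mu], and the restriction to [B] and
    [D] is absorbed into the integrand, extended by zero. *)
Lemma tonelli_setI d d' {T : measurableType d} {Y : measurableType d'} {R : realType}
    (Q : probability T R) (mu : {measure set Y -> \bar R}) (B : set T) (D : set Y)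
    (f : T * Y -> \bar R) :
  sigma_finite setT mu -> measurable B -> measurable D ->
  measurable_fun setT f -> (forall x, 0 <= f x)%E ->
  (\int[Q]_(t in B) \int[mu]_(y in D) f (t, y) =
   \int[mu]_(y in D) \int[Q]_(t in B) f (t, y))%E.
Proof.
move=> sf mB mD mf f0.
pose H1 := isSFinite.Build _ _ _ (Measure.sort mu) (sfinite_measure_sigma_finite sf).
pose H2 := isSigmaFinite.Build _ _ _ (Measure.sort mu) sf.
pose smu : {sigma_finite_measure set Y -> \bar R} :=
  HB.pack_for (SigmaFiniteMeasure.type Y R) (Measure.sort mu) H1 H2.
pose g := f \_ (B `*` D).
have mg : measurable_fun setT g.
  apply/measurable_restrict => //; first exact: measurableX.
  exact: measurable_funTS.
have g0 x : (0 <= g x)%E by rewrite /g /patch; case: ifP.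
have := @fubini_tonelli _ _ _ _ _ Q smu g mg g0.
rewrite [X in X = _ -> _](_ : _ = \int[Q]_(t in B) \int[mu]_(y in D) f (t, y))%E; last first.
  rewrite [RHS]integral_mkcond; apply: eq_integral => t _; rewrite [in RHS]/patch.
  case: ifPn => tB.
    rewrite [RHS]integral_mkcond; apply: eq_integral => y _.
    by rewrite /g /patch in_setX tB.
  rewrite -[RHS](integral0 mu setT); apply: eq_integral => y _.
  by rewrite /g /patch in_setX (negbTE tB).
move=> ->; rewrite [RHS]integral_mkcond; apply: eq_integral => y _; rewrite [in RHS]/patch.
case: ifPn => yD.
  rewrite [RHS]integral_mkcond; apply: eq_integral => t _.
  by rewrite /g /patch in_setX yD andbT.
rewrite -[RHS](integral0 Q setT); apply: eq_integral => t _.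
by rewrite /g /patch in_setX (negbTE yD) andbF.
Qed.

Lemma measurable_fun_integral_snd d d' {T : measurableType d} {Y : measurableType d'}
    {R : realType} (Q : probability T R) (B : set T) (f : T * Y -> \bar R) :
  measurable B -> measurable_fun setT f -> (forall x, 0 <= f x)%E ->
  measurable_fun setT (fun y => \int[Q]_(t in B) f (t, y))%E.
Proof.
move=> mB mf f0; pose g := f \_ (B `*` setT).
have mg : measurable_fun setT g.
  apply/measurable_restrict => //; first exact: measurableX.
  exact: measurable_funTS.
have g0 x : (0 <= g x)%E by rewrite /g /patch; case: ifP.
have := @measurable_fun_fubini_tonelli_G _ _ _ _ _ Q g mg g0.
apply: eq_measurable_fun => y _; rewrite /fubini_G [RHS]integral_mkcond.
by apply: eq_integral => t _; rewrite /g /patch in_setX in_setT andbT.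
Qed.

Lemma measurable_fun_integral_fst d d' {T : measurableType d} {Y : measurableType d'}
    {R : realType} (mu : {measure set Y -> \bar R}) (D : set Y) (f : T * Y -> \bar R) :
  sigma_finite setT mu -> measurable D -> measurable_fun setT f -> (forall x, 0 <= f x)%E ->
  measurable_fun setT (fun t => \int[mu]_(y in D) f (t, y))%E.
Proof.
move=> sf mD mf f0.
pose H1 := isSFinite.Build _ _ _ (Measure.sort mu) (sfinite_measure_sigma_finite sf).
pose H2 := isSigmaFinite.Build _ _ _ (Measure.sort mu) sf.
pose smu : {sigma_finite_measure set Y -> \bar R} :=
  HB.pack_for (SigmaFiniteMeasure.type Y R) (Measure.sort mu) H1 H2.
pose g := f \_ (setT `*` D).
have mg : measurable_fun setT g.
  apply/measurable_restrict => //; first exact: measurableX.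
  exact: measurable_funTS.
have g0 x : (0 <= g x)%E by rewrite /g /patch; case: ifP.
have := @measurable_fun_fubini_tonelli_F _ _ _ _ _ smu g mg g0.
apply: eq_measurable_fun => t _; rewrite /fubini_F [RHS]integral_mkcond.
by apply: eq_integral => y _; rewrite /g /patch in_setX in_setT.
Qed.

(** On the event the evidence over [B] is too small to account for more than half of p b in the
    integrated [le_powR_tilt], so the tilted part carries the other half. Tonelli and the divergence
    bound on [B] control the integral of that part. *)
Lemma evidence_lower_bound d d' {T : measurableType d} {Y : measurableType d'}
    {R : realType} (Q : probability T R) (mu : {measure set Y -> \bar R}) (B : set T)
    (p : Y -> R) (f : T -> Y -> R) (rho K w b : R) :
  sigma_finite setT mu -> measurable B -> Q B = b%:E -> 0 < b ->
  is_pos_density mu p -> (forall t, is_pos_density mu (f t)) ->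
  measurable_fun setT (fun x : T * Y => f x.1 x.2) -> 1 < rho -> 0 < K ->
  (forall t, B t -> renyi mu rho p (f t) <= w%:E)%E ->
  (\int[mu]_(y in [set y | (2 * K)%:E * \int[Q]_(t in B) (f t y)%:E <= (p y * b)%:E])
     (p y)%:E <= (2 * K `^ (1 - rho) * expR ((rho - 1) * w))%:E)%E.
Proof.
move=> sf mB QB b0 [mp p0 ip] df mf rho1 K0 rw.
have f0 t y : 0 < f t y by have [_ ? _] := df t.
have mfe : measurable_fun setT (fun x : T * Y => (f x.1 x.2)%:E) by exact/measurable_EFinP.
pose h (x : T * Y) := ((p x.2 / f x.1 x.2) `^ (rho - 1) * p x.2)%:E.
have h0 x : (0 <= h x)%E by rewrite lee_fin mulr_ge0 ?powR_ge0 ?(ltW (p0 _)).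
have mh : measurable_fun setT h.
  by apply/measurable_EFinP; apply: measurable_tilt => //; exact: measurableT_comp.
have mI : measurable_fun setT (fun y => \int[Q]_(t in B) (f t y)%:E)%E.
  by apply: (measurable_fun_integral_snd _ _ Q B _ mB mfe) => x; rewrite lee_fin ltW.
have mH := measurable_fun_integral_snd _ _ Q B _ mB mh h0.
set N := [set y | _].
have mN : measurable N.
  rewrite -[N]setTI; apply: measurable_lee => //; first exact: measurable_funeM.
  by apply/measurable_EFinP; exact: measurable_funM.
(* Integrating [le_powR_tilt] over [B] gives p b <= K (evidence over B) + K^(1 - rho) (tilted
   integral), and on [N] the first term is at most p b / 2. *)
have ptw y : N y -> ((b / 2)%:E * (p y)%:E <=
    (K `^ (1 - rho))%:E * \int[Q]_(t in B) h (t, y))%E.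
  rewrite /N /= => Ny.
  have mfy : measurable_fun B (fun t => (f t y)%:E).
    by apply: measurable_funTS; exact: (measurableT_comp mfe (pair2_measurable y)).
  have mhy : measurable_fun B (fun t => h (t, y)).
    by apply: measurable_funTS; exact: (measurableT_comp mh (pair2_measurable y)).
  have : ((p y * b)%:E <= K%:E * \int[Q]_(t in B) (f t y)%:E +
      (K `^ (1 - rho))%:E * \int[Q]_(t in B) h (t, y))%E.
    rewrite EFinM -QB -integral_cst//.
    rewrite -ge0_integralZl_EFin//; last 2 first.
    - by move=> t _; rewrite lee_fin ltW.
    - exact: ltW.
    rewrite -ge0_integralZl_EFin ?powR_ge0// -ge0_integralD//; last 4 first.
    - by move=> t _; rewrite mule_ge0// lee_fin ltW.
    - exact: measurable_funeM.
    - by move=> t _; rewrite mule_ge0// lee_fin powR_ge0.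
    - exact: measurable_funeM.
    apply: ge0_le_integral => //.
    - by move=> t _; rewrite lee_fin ltW.
    - by apply: emeasurable_funD; exact: measurable_funeM.
    - by move=> t _; rewrite -!EFinM -EFinD lee_fin; exact: le_powR_tilt.
  have : (0 <= (K `^ (1 - rho))%:E * \int[Q]_(t in B) h (t, y))%E.
    by rewrite mule_ge0 ?lee_fin ?powR_ge0//; exact: integral_ge0.
  case: (X in (0 <= X)%E -> _) => [r| |]//; last by move=> *; rewrite leey.
  move: Ny; have : (0 <= \int[Q]_(t in B) (f t y)%:E)%E.
    by apply: integral_ge0 => t _; rewrite lee_fin ltW.
  case: integral => [a|//|//] => _; last by rewrite gt0_muley// lte_fin mulr_gt0.
  rewrite -!EFinM -EFinD !lee_fin; lra.
have : ((b / 2)%:E * \int[mu]_(y in N) (p y)%:E <=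
    (b / 2)%:E * (2 * K `^ (1 - rho) * expR ((rho - 1) * w))%:E)%E.
  rewrite -ge0_integralZl_EFin//; last 3 first.
  - by move=> y _; rewrite lee_fin ltW.
  - by apply/measurable_EFinP; exact: measurable_funTS.
  - by rewrite divr_ge0// ltW.
  apply: (@le_trans _ _ (\int[mu]_(y in N)
      ((K `^ (1 - rho))%:E * \int[Q]_(t in B) h (t, y)))%E).
    apply: ge0_le_integral => //.
    - by move=> y _; rewrite -EFinM lee_fin mulr_ge0 ?divr_ge0 ?(ltW b0) ?(ltW (p0 _)).
    - by apply: measurable_funeM; apply/measurable_EFinP; exact: measurable_funTS.
    - by apply: measurable_funeM; exact: measurable_funTS.
  rewrite ge0_integralZl_EFin ?powR_ge0//; last 2 first.
  - by move=> y _; exact: integral_ge0.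
  - exact: measurable_funTS.
  rewrite -tonelli_setI//.
  rewrite -EFinM; have -> : b / 2 * (2 * K `^ (1 - rho) * expR ((rho - 1) * w)) =
      K `^ (1 - rho) * (expR ((rho - 1) * w) * b) by field.
  rewrite [leRHS]EFinM; apply: lee_wpmul2l; first by rewrite lee_fin powR_ge0.
  rewrite EFinM -QB -integral_cst//.
  apply: ge0_le_integral => //.
  - by move=> t _; exact: integral_ge0.
  - by apply: measurable_funTS; exact: measurable_fun_integral_fst.
  - move=> t Bt; apply: le_trans (renyi_le_integral _ _ _ _ _ _ rho1 p0 (rw t Bt)).
    apply: ge0_subset_integral => //.
    exact: (measurableT_comp mh (pair1_measurable t)).
rewrite lee_pmul2l// lte_fin divr_gt0//.
Qed.

(** Outside the bad evidence event the normalizing constant exceeds p b / (2 K), because it is at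
    least the evidence over [B]. *)
Lemma posterior_mass_le d {T : measurableType d} {R : realType} (Q P : probability T R)
    (g : T -> R) (B U : set T) (K b p : R) :
  measurable B -> measurable U -> measurable_fun setT g -> (forall t, 0 < g t) ->
  (forall A, measurable A ->
    P A = \int[Q]_(t in A) (g t)%:E * ((fine (\int[Q]_t (g t)%:E))^-1)%:E)%E ->
  0 < K -> 0 < b -> 0 <= p -> ((p * b)%:E < (2 * K)%:E * \int[Q]_(t in B) (g t)%:E)%E ->
  (P U * p%:E <= (2 * K / b)%:E * \int[Q]_(t in U) (g t)%:E)%E.
Proof.
move=> mB mU mg g0 HP K0 b0 p0.
have mge : measurable_fun setT (EFin \o g) by exact/measurable_EFinP.
have int0 A : (0 <= \int[Q]_(t in A) (g t)%:E)%E.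
  by apply: integral_ge0 => t _; rewrite lee_fin ltW.
have sub A : measurable A -> (\int[Q]_(t in A) (g t)%:E <= \int[Q]_t (g t)%:E)%E.
  by move=> mA; apply: ge0_subset_integral => // t _; rewrite lee_fin ltW.
have := HP _ measurableT; rewrite probability_setT HP//.
move: (sub B mB) (sub U mU) (int0 setT) (int0 U) (int0 B).
(* An infinite normalizing constant has [fine] equal to 0 and would give the posterior total mass 0
   instead of 1. *)
case: (\int[Q]_t _)%E => [r| |]//; last first.
  by rewrite /= invr0 !mule0 => _ _ _ _ _ [/eqP]; rewrite ?(eq_sym 0) oner_eq0.
case: (\int[Q]_(t in U) _)%E => [u| |]//; case: (\int[Q]_(t in B) _)%E => [a| |]//=.
rewrite -!EFinM !lee_fin lte_fin => ar ur r0 u0 a0 [r1] h.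
have rp : 0 < r.
  rewrite lt_neqAle r0 andbT; apply/eqP => r00; move: r1; rewrite -r00 mul0r => /eqP.
  by rewrite oner_eq0.
have -> : u / r * p = u * (p / r) by ring.
rewrite [leRHS]mulrC; apply: ler_wpM2l => //; rewrite ler_pdivrMr//.
rewrite mulrAC ler_pdivlMr//; nra.
Qed.

(** [F] is the rejection region of the tests. On [F] and on the bad evidence event the variational
    mass is bounded by 1; elsewhere [donsker_varadhan_set] and [posterior_mass_le] apply pointwise,
    and the result is integrated over the data. *)
Lemma variational_risk_bound d d' {T : measurableType d} {Y : measurableType d'}
    {R : realType} (Q : probability T R) (mu : {measure set Y -> \bar R})
    (post Xi : Y -> probability T R) (I : Y -> \bar R) (p : Y -> R) (f : T -> Y -> R)
    (U U' B : set T) (F : set Y) (K b w rho s eF eU eB k : R) :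
  sigma_finite setT mu -> measurable U -> measurable U' -> measurable B -> measurable F ->
  is_pos_density mu p -> (forall t, is_pos_density mu (f t)) ->
  measurable_fun setT (fun x : T * Y => f x.1 x.2) ->
  (forall y A, measurable A -> post y A =
    \int[Q]_(t in A) (f t y)%:E * ((fine (\int[Q]_t (f t y)%:E))^-1)%:E)%E ->
  measurable_fun setT (fun y => Xi y U) -> measurable_fun setT I ->
  (forall y, KL (Xi y) (post y) <= I y)%E ->
  1 < rho -> 0 < K -> 0 < b -> Q B = b%:E ->
  (forall t, B t -> renyi mu rho p (f t) <= w%:E)%E ->
  (\int[mu]_(y in F) (p y)%:E <= eF%:E)%E ->
  0 <= eU -> (forall t, U' t -> \int[mu]_(y in ~` F) (f t y)%:E <= eU%:E)%E ->
  (Q (U `\` U') <= eB%:E)%E -> (\int[mu]_y (I y * (p y)%:E) <= k%:E)%E -> 0 < s ->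
  (\int[mu]_y (Xi y U * (p y)%:E) <=
    (eF + 2 * K `^ (1 - rho) * expR ((rho - 1) * w) +
     (k + expR s * (2 * K / b) * (eU + eB)) / s)%:E)%E.
Proof.
move=> sf mU mU' mB mF dp df mf Hpost mXi mI KLI rho1 K0 b0 QB Bw FeF eU0 U'eU UeB Ik s0.
have [mp p0 ip] := dp.
have f0 t y : 0 < f t y by have [_ ? _] := df t.
have := evidence_lower_bound _ _ _ _ B p f rho K w b sf mB QB b0 dp df mf rho1 K0 Bw.
have mfe : measurable_fun setT (fun x : T * Y => (f x.1 x.2)%:E) by exact/measurable_EFinP.
have mW A : measurable A -> measurable_fun setT (fun y => \int[Q]_(t in A) (f t y)%:E)%E.
  by move=> mA; apply: (measurable_fun_integral_snd _ _ Q A _ mA mfe) => x; rewrite lee_fin ltW.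
(* N is the event that the evidence over B is too small. *)
set N := [set y | _] => NeN.
have mN : measurable N.
  rewrite -[N]setTI; apply: measurable_lee => //; first by apply: measurable_funeM; exact: mW.
  by apply/measurable_EFinP; exact: measurable_funM.
pose W y := (\int[Q]_(t in U) (f t y)%:E)%E.
have W0 y : (0 <= W y)%E by apply: integral_ge0 => t _; rewrite lee_fin ltW.
have I0 y : (0 <= I y)%E := le_trans (KL_ge0 _ _ _) (KLI y).
pose c := expR s * (2 * K / b).
have c0 : 0 <= c by rewrite !mulr_ge0 ?expR_ge0 ?invr_ge0 ?(ltW K0) ?(ltW b0).
have pe0 y : (0 <= (p y)%:E)%E by rewrite lee_fin ltW.
have patch0 (D : set Y) (h : Y -> \bar R) y : (forall y, 0 <= h y)%E -> (0 <= (h \_ D) y)%E.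
  by move=> h0; rewrite /patch; case: ifP.
have mpe : measurable_fun setT (EFin \o p) by exact/measurable_EFinP.
have mpF : measurable_fun setT ((EFin \o p) \_ F).
  by apply/(measurable_restrictT _ mF); exact: measurable_funTS.
have mpN : measurable_fun setT ((EFin \o p) \_ N).
  by apply/(measurable_restrictT _ mN); exact: measurable_funTS.
have mWF : measurable_fun setT (W \_ (~` F)).
  by apply/(measurable_restrictT _ (measurableC mF)); apply: measurable_funTS; exact: mW.
(* The factor [s] remains on the left until the end, so that every term is a nonnegative multiple of
   something integrable by pieces. *)
have ptw y : (s%:E * (Xi y U * (p y)%:E) <= s%:E * ((EFin \o p) \_ F) y +
    (s%:E * ((EFin \o p) \_ N) y + (I y * (p y)%:E + c%:E * (W \_ (~` F)) y)))%E.
  have triv : (s%:E * (Xi y U * (p y)%:E) <= s%:E * (p y)%:E)%E.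
    apply: lee_wpmul2l; first by rewrite lee_fin ltW.
    by rewrite -[leRHS]mul1e lee_wpmul2r// probability_le1.
  have s0' : (0 <= s%:E)%E by rewrite lee_fin ltW.
  have Ip0 : (0 <= I y * (p y)%:E + c%:E * (W \_ (~` F)) y)%E.
    by rewrite adde_ge0 ?mule_ge0 ?patch0.
  have [yF|yF] := boolP (y \in F).
    apply: (le_trans triv); rewrite [X in (s%:E * X + _)%E]/patch yF.
    by rewrite leeDl// adde_ge0// mule_ge0// patch0.
  have [yN|yN] := boolP (y \in N).
    apply: (le_trans triv); rewrite [X in (_ + (s%:E * X + _))%E]/patch yN.
    rewrite -[leLHS]add0e; apply: leeD; first by rewrite mule_ge0 ?patch0.
    by rewrite leeDl.
  rewrite [X in (s%:E * X + _)%E]/patch (negbTE yF) [X in (_ + (s%:E * X + _))%E]/patch (negbTE yN).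
  rewrite [X in (c%:E * X)%E]/patch in_setC yF !mule0 !add0e.
  have py := p0 y.
  have post_le := posterior_mass_le _ Q (post y) (f ^~ y) B U K b (p y).
  rewrite muleA; apply: (@le_trans _ _ ((I y + (expR s)%:E * post y U) * (p y)%:E)%E).
    rewrite lee_wpmul2r//; apply: le_trans (donsker_varadhan_set _ _ (post y) _ _ (ltW s0) mU) _.
    by rewrite leeD.
  rewrite ge0_muleDl//; last by rewrite mule_ge0// lee_fin expR_ge0.
  rewrite leeD// -muleA EFinM -muleA; apply: lee_wpmul2l; first by rewrite lee_fin expR_ge0.
  apply: post_le => //.
  - exact: (measurableT_comp mf (pair2_measurable y)).
  - exact: Hpost.
  - exact: ltW.
  - by move: yN; rewrite notin_setE /N /= => /negP; rewrite -ltNge.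
have int_le : (\int[mu]_y (s%:E * (Xi y U * (p y)%:E)) <=
    (s * eF + (s * (2 * K `^ (1 - rho) * expR ((rho - 1) * w)) + (k + c * (eU + eB))))%:E)%E.
  have s0' : (0 <= s%:E)%E by rewrite lee_fin ltW.
  apply: (@le_trans _ _ (\int[mu]_y (s%:E * ((EFin \o p) \_ F) y +
      (s%:E * ((EFin \o p) \_ N) y + (I y * (p y)%:E + c%:E * (W \_ (~` F)) y))))%E).
    apply: ge0_le_integral => //.
    - by move=> y _; rewrite !mule_ge0.
    - by apply: measurable_funeM; exact: emeasurable_funM.
    - apply: emeasurable_funD; first exact: measurable_funeM.
      apply: emeasurable_funD; first exact: measurable_funeM.
      apply: emeasurable_funD; last exact: measurable_funeM.
      exact: emeasurable_funM.
  rewrite ge0_integralD//; last 4 first.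
  - by move=> y _; rewrite mule_ge0 ?patch0.
  - exact: measurable_funeM.
  - by move=> y _; rewrite !adde_ge0 ?mule_ge0 ?patch0.
  - apply: emeasurable_funD; first exact: measurable_funeM.
    apply: emeasurable_funD; last exact: measurable_funeM.
    exact: emeasurable_funM.
  rewrite EFinD; apply: leeD.
    rewrite ge0_integralZl_EFin ?(ltW s0)//.
      by rewrite -integral_mkcond EFinM lee_wpmul2l.
    by move=> y _; rewrite patch0.
  rewrite ge0_integralD//; last 4 first.
  - by move=> y _; rewrite mule_ge0 ?patch0.
  - exact: measurable_funeM.
  - by move=> y _; rewrite !adde_ge0 ?mule_ge0 ?patch0.
  - apply: emeasurable_funD; last exact: measurable_funeM.
    exact: emeasurable_funM.
  rewrite EFinD; apply: leeD.
    rewrite ge0_integralZl_EFin ?(ltW s0)//.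
      by rewrite -integral_mkcond EFinM lee_wpmul2l.
    by move=> y _; rewrite patch0.
  rewrite ge0_integralD//; last 4 first.
  - by move=> y _; rewrite mule_ge0.
  - exact: emeasurable_funM.
  - by move=> y _; rewrite mule_ge0 ?patch0.
  - exact: measurable_funeM.
  rewrite EFinD; apply: leeD => //.
  rewrite ge0_integralZl_EFin//; last by move=> y _; rewrite patch0.
  rewrite -integral_mkcond [leRHS]EFinM; apply: lee_wpmul2l => //.
  (* After the exchange the inner integral is the probability of acceptance under parameter [t]: at
     most [eU] on [U'], and at most 1 on the rest of [U], whose prior mass is at most [eB]. *)
  rewrite /W -(tonelli_setI _ _ Q mu U (~` F) (fun x => (f x.1 x.2)%:E))//; last 2 first.
  - exact: measurableC.
  - by move=> x; rewrite lee_fin ltW.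
  apply: (@le_trans _ _ (\int[Q]_(t in U) (eU%:E + (\1_(U `\` U') t)%:E))%E).
    apply: ge0_le_integral => //.
    - by move=> t _; apply: integral_ge0 => y _; rewrite lee_fin ltW.
    - apply: measurable_funTS.
      apply: (measurable_fun_integral_fst _ _ mu (~` F) (fun x => (f x.1 x.2)%:E)) => //.
        exact: measurableC.
      by move=> x; rewrite lee_fin ltW.
    - apply: emeasurable_funD => //; apply/measurable_EFinP; apply: measurable_funTS.
      by apply: measurable_indic; exact: measurableD.
    move=> t Ut; rewrite indicE; have [tU'|tU'] := boolP (t \in U').
      apply: (le_trans (U'eU t _)); first by rewrite inE in tU'.
      by rewrite leeDl// lee_fin.
    have -> : (t \in U `\` U') = true.
      by apply/mem_set; split => //; move: tU'; rewrite notin_setE.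
    have [mft _ <-] := df t; apply: (@le_trans _ _ (\int[mu]_y (f t y)%:E)%E).
      apply: ge0_subset_integral => //; first exact: measurableC.
        exact/measurable_EFinP.
      by move=> y _; rewrite lee_fin ltW.
    by rewrite leeDr// lee_fin.
  rewrite ge0_integralD//; last first.
    apply/measurable_EFinP; apply: measurable_funTS.
    by apply: measurable_indic; exact: measurableD.
  rewrite EFinD; apply: leeD.
    rewrite integral_cst// -[leRHS]mule1; apply: lee_wpmul2l; first by rewrite lee_fin.
    exact: probability_le1.
  rewrite integral_indic//; last exact: measurableD.
  by rewrite setIidl// => t [].
have Xp0 y : (0 <= Xi y U * (p y)%:E)%E by rewrite mule_ge0.
move: int_le; rewrite ge0_integralZl_EFin//; last 2 first.
- exact: emeasurable_funM.
- exact: ltW.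
have : (0 <= \int[mu]_y (Xi y U * (p y)%:E))%E by exact: integral_ge0.
case: integral => [r| |]//; last by rewrite gt0_muley// lte_fin.
move=> _; rewrite -EFinM !lee_fin -/c => h.
rewrite -(ler_pM2l s0); apply: (le_trans h).
have sE x y z : s * (x + y + z / s) = s * x + (s * y + z) by field; rewrite gt_eqF.
by rewrite sE.
Qed.

(** * Tests over sieves and prior masses *)

Lemma expR_powR {R : realType} (x y : R) : expR x `^ y = expR (y * x).
Proof. by rewrite /powR gt_eqF ?expR_gt0// expRK. Qed.

(** The proof [dp] is an argument because the measure structure declared below rests on the
    measurability and positivity that it contains. *)
Definition density_measure d {Y : measurableType d} {R : realType}
    {mu : {measure set Y -> \bar R}} {p : Y -> R} (dp : is_pos_density mu p)
    (A : set Y) : \bar R := (\int[mu]_(y in A) (p y)%:E)%E.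

Section density_measure.
Context d {Y : measurableType d} {R : realType} {mu : {measure set Y -> \bar R}}
  {p : Y -> R} (dp : is_pos_density mu p).

Let density_measure0 : density_measure _ dp set0 = 0%E.
Proof. exact: integral_set0. Qed.

Let density_measure_ge0 A : (0 <= density_measure _ dp A)%E.
Proof. by apply: integral_ge0 => y _; case: dp => _ p0 _; rewrite lee_fin ltW. Qed.

Let density_measure_sigma_additive : semi_sigma_additive (density_measure _ dp).
Proof.
have [mp p0 _] := dp; apply: semi_sigma_additive_nng_induced.
  exact/measurable_EFinP.
by move=> y; rewrite lee_fin ltW.
Qed.

HB.instance Definition _ := isMeasure.Build d Y R (density_measure _ dp)
  density_measure0 density_measure_ge0 density_measure_sigma_additive.
End density_measure.

Lemma measure_list_union d {Y : measurableType d} {R : realType} {I : Type}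
    (nu : {measure set Y -> \bar R}) (F : I -> set Y) (s : seq I) (e : R) :
  (forall i, measurable (F i)) -> (forall i, nu (F i) <= e%:E)%E ->
  measurable [set y | exists2 i, List.In i s & F i y] /\
  (nu [set y | exists2 i, List.In i s & F i y] <= ((size s)%:R * e)%:E)%E.
Proof.
move=> mF Fe; elim: s => [|i s [mIH IH]].
  rewrite (_ : [set y | _] = set0).
    by split; [exact: measurable0|rewrite measure0 mul0r].
  by rewrite -subset0 => y [].
have -> : [set y | exists2 j, List.In j (i :: s) & F j y] =
    F i `|` [set y | exists2 j, List.In j s & F j y].
  apply/seteqP; split=> y /=.
    by move=> [j [<-|js] Fj]; [left|right; exists j].
  by move=> [Fi|[j js Fj]]; [exists i; [left|]|exists j; [right|]].
split; first exact: measurableU.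
apply: le_trans (measureU2 _ (mF i) mIH) _.
by rewrite /= -natr1 mulrDl mul1r addrC EFinD leeD.
Qed.

(** Since 2 x (i + 1)^2 >= x + (i + 1) and e >= 2, the errors over all shells are dominated by a
    geometric series of total e^(-x). *)
Lemma shell_weight_le {R : realType} (x : R) (i : nat) : 1 <= x ->
  expR (- (2 * x * i.+1%:R ^+ 2)) <= expR (- x) / (2 ^ i.+1)%:R.
Proof.
move=> x1; have i1 : 1 <= i.+1%:R :> R by rewrite ler1n.
apply: (@le_trans _ _ (expR (- x) * expR (- i.+1%:R))).
  by rewrite -expRD ler_expR; nra.
rewrite ler_wpM2l ?expR_ge0// expRN natrX lef_pV2 ?posrE ?expR_gt0 ?exprn_gt0//.
rewrite -[i.+1%:R]mul1r expRM_natr lerXn2r ?nnegrE ?expR_ge0//.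
by have := expR_ge1Dx (1 : R); rewrite -[1 + 1]/(2).
Qed.

(** Both bounds of (A) at one sample size, with [N] the real number n. *)
Definition renyi_sandwich {d} {Y : measurableType d} {R : realType}
    (mu : {measure set Y -> \bar R}) {L : Type} (dist : L -> L -> R) (q : L -> Y -> R)
    (N rho0 rhop a1 a2 c1 c2 : R) : Prop :=
  forall l0 l1,
    ((a1 + c1 * N * dist l0 l1 ^+ 2)%:E <= renyi mu rho0 (q l0) (q l1))%E /\
    (renyi mu rhop (q l0) (q l1) <= (a2 + c2 * N * dist l0 l1 ^+ 2)%:E)%E.

(** The centre [l'] lies at distance at least z / 2 from the truth, so the affinity exponent (1 -
    rho0) c1 N z^2 / 4 equals 2 b N z^2. For densities near the centre, half of it pays for the
    change of measure. *)
Lemma separated_test_errors d {Y : measurableType d} {R : realType}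
    (mu : {measure set Y -> \bar R}) {L : Type} (dist : L -> L -> R) (q : L -> Y -> R)
    (N rho0 rhop a1 a2 c1 c2 u z : R) (l l' : L) :
  is_metric dist -> (forall l, is_pos_density mu (q l)) -> 0 <= N ->
  0 < rho0 < 1 -> 1 < rhop -> 0 < c1 <= c2 -> 16 * (c2 * u ^+ 2) <= (1 - rho0) * c1 ->
  renyi_sandwich mu dist q N rho0 rhop a1 a2 c1 c2 -> 0 <= z -> 0 <= u ->
  z / 2 <= dist l' l ->
  let b := (1 - rho0) * c1 / 8 in
  let G := [set y | (q l y <= q l' y)%R] in
  (\int[mu]_(y in G) (q l y)%:E <=
     (expR (- ((1 - rho0) * a1)) * expR (- (2 * (b * (N * z ^+ 2)))))%:E)%E /\
  (forall l'', (dist l'' l' <= u * z)%R -> \int[mu]_(y in ~` G) (q l'' y)%:E <=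
     (expR (- ((1 - rho0) * a1)) * expR (- (b * (N * z ^+ 2))) +
      expR ((rhop - 1) * a2) * expR (- ((rhop - 1) * b / 2 * (N * z ^+ 2))))%:E)%E.
Proof.
move=> [d0 _ dC _] dq N0 rho01 rhop1 /andP[c10 c12] uc sand z0 u0 sep b G.
have [rho00 rho01'] := andP rho01.
have b0 : 0 <= b by rewrite /b; nra.
have [[mq _ _] [mq' _ _]] := (dq l, dq l').
have mG : measurable G by rewrite -[G]setTI; exact: measurable_fun_le.
have zz : z ^+ 2 / 4 <= dist l l' ^+ 2.
  by rewrite dC; have := d0 l' l; nra.
have le1 : expR (- ((1 - rho0) * (a1 + c1 * N * dist l l' ^+ 2))) <=
    expR (- ((1 - rho0) * a1)) * expR (- (2 * (b * (N * z ^+ 2)))).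
  rewrite -expRD ler_expR /b.
  have : (1 - rho0) * c1 * N * (z ^+ 2 / 4) <= (1 - rho0) * c1 * N * dist l l' ^+ 2.
    by apply: ler_wpM2l => //; rewrite !mulr_ge0// ?subr_ge0 ltW.
  by lra.
have [e1 e2] := likelihood_test_errors _ mu rho0 _ _ _ rho01 (dq l) (dq l') (sand l l').1.
split=> [|l'' l''l']; first by apply: (le_trans e1); rewrite lee_fin.
(* The level e^(b N z^2) leaves the exponent -b N z^2 in the first term. In the second, the
   smallness of [u] gives c2 u^2 <= b / 2, so half of the gain (rhop - 1) b N z^2 survives. *)
have K0 := expR_gt0 (b * (N * z ^+ 2)).
apply: le_trans (renyi_change_of_measure _ mu rhop _ _ _ _ (~` G) rhop1 K0
  (measurableC mG) (dq l'') (dq l') (sand l'' l').2) _.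
rewrite [leRHS]EFinD; apply: leeD.
  apply: (@le_trans _ _ ((expR (b * (N * z ^+ 2)))%:E *
      (expR (- ((1 - rho0) * a1)) * expR (- (2 * (b * (N * z ^+ 2)))))%:E)%E).
    apply: lee_wpmul2l; first by rewrite lee_fin ltW.
    by apply: (le_trans e2); rewrite lee_fin.
  by rewrite -EFinM lee_fin -!expRD ler_expR; lra.
rewrite lee_fin expR_powR -!expRD ler_expR.
have : (rhop - 1) * (c2 * N) * dist l'' l' ^+ 2 <= (rhop - 1) * (c2 * N) * (u * z) ^+ 2.
  apply: ler_wpM2l; first by rewrite !mulr_ge0 ?subr_ge0 ?(ltW rhop1)// (le_trans _ c12)// ltW.
  by rewrite lerXn2r ?nnegrE ?mulr_ge0.
have : (rhop - 1) * N * z ^+ 2 * (c2 * u ^+ 2) <= (rhop - 1) * N * z ^+ 2 * (b / 2).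
  apply: ler_wpM2l; first by rewrite !mulr_ge0 ?subr_ge0 ?(ltW rhop1)// exprn_ge0.
  by rewrite /b; lra.
by rewrite exprMn; lra.
Qed.

(** [F] is the union of the tests over models, shells and cover centres. The entropy bound does not
    depend on the shell, so the shells contribute a geometric sum and the models the sum [S]. *)
Lemma sieve_test d {Y : measurableType d} {R : realType}
    (mu : {measure set Y -> \bar R}) {L Th : Type} (dist : L -> L -> R) (q : L -> Y -> R)
    {M : countType} (T : Th -> L) (Theta : M -> set Th) (zeta : M -> R) (D : set M)
    (N rho0 rhop a1 a2 c1 c2 u cu r S : R) (l : L) :
  is_metric dist -> (forall l, is_pos_density mu (q l)) -> 0 <= N ->
  0 < rho0 < 1 -> 1 < rhop -> 0 < c1 <= c2 ->
  16 * (c2 * u ^+ 2) <= (1 - rho0) * c1 -> 0 <= u <= 2^-1 ->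
  renyi_sandwich mu dist q N rho0 rhop a1 a2 c1 c2 ->
  0 < r -> (forall m, D m -> zeta m < r) ->
  (forall m, D m -> forall z, (zeta m < z)%R ->
    log_covering_number dist T (u * z) [set t | Theta m t /\ (dist (T t) l <= 2 * z)%R]
      <= (cu * N * zeta m ^+ 2)%:E)%E ->
  (\esum_(m in D) (expR (cu * N * zeta m ^+ 2))%:E <= S%:E)%E ->
  let b := (1 - rho0) * c1 / 8 in
  1 <= b * (N * r ^+ 2) ->
  exists F : set Y, [/\ measurable F,
    (\int[mu]_(y in F) (q l y)%:E <=
      (2 * expR (- ((1 - rho0) * a1)) * expR (- (b * (N * r ^+ 2))) * S)%:E)%E &
    forall m t, D m -> Theta m t -> r <= dist (T t) l ->
      (\int[mu]_(y in ~` F) (q (T t) y)%:E <=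
        (expR (- ((1 - rho0) * a1)) * expR (- (b * (N * r ^+ 2))) +
         expR ((rhop - 1) * a2) * expR (- ((rhop - 1) * b / 2 * (N * r ^+ 2))))%:E)%E].
Proof.
move=> mdist dq N0 rho01 rhop1 c1c2 uc /andP[u0 u12] sand r0 Dr cover SD b bX.
(* Shell i runs from (i + 1) r to (i + 2) r; it lies in the ball of radius 2 [z i] because i + 2 <=
   2 (i + 1). *)
pose z (i : nat) : R := i.+1%:R * r.
have rz i : r <= z i by rewrite /z ler_peMl ?(ltW r0)// ler1n.
have z0 i : 0 < z i := lt_le_trans r0 (rz i).
pose S_ m i := [set t | Theta m t /\ (dist (T t) l <= 2 * z i)%R].
(* One cover is chosen for each model and shell at once; models outside [D] get the empty list. *)
have /choice[c hc] : forall k : M * nat, exists c : seq Th, D k.1 ->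
    is_cover dist T (u * z k.2) (S_ k.1 k.2) c /\
    (size c)%:R <= 2 * expR (cu * N * zeta k.1 ^+ 2).
  move=> [m i] /=; have [Dm|nDm] := pselect (D m); last by exists nil.
  have [c c1' c2'] := exists_cover_of_log _ _ _ _ _ (cover m Dm _ (lt_le_trans (Dr m Dm) (rz i))).
  by exists c.
(* Cover points closer than z i / 2 to l serve no shell and get the trivial test. *)
pose G i t := if z i / 2 <= dist (T t) l then [set y | (q l y <= q (T t) y)%R] else set0.
have mG i t : measurable (G i t).
  rewrite /G; case: ifP => // _; rewrite -[X in measurable X]setTI.
  by apply: measurable_fun_le => //; [case: (dq l)|case: (dq (T t))].
pose nu : {measure set Y -> \bar R} := density_measure _ (dq l).
pose C := expR (- ((1 - rho0) * a1)).
have C0 : 0 < C := expR_gt0 _.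
have nuG i t : (nu (G i t) <= (C * expR (- (2 * (b * (N * z i ^+ 2)))))%:E)%E.
  rewrite /G; case: ifPn => [sep|_]; last first.
    by rewrite measure0 lee_fin mulr_ge0 ?expR_ge0.
  exact: (separated_test_errors _ mu _ _ _ _ _ _ _ _ _ _ _ _ _ mdist dq N0 rho01
    rhop1 c1c2 uc sand (ltW (z0 i)) u0 sep).1.
pose F_ m i := [set y | exists2 t, List.In t (c (m, i)) & G i t y].
have hF m i := measure_list_union _ nu (G i) (c (m, i)) _ (mG i) (nuG i).
have mF_ m i : measurable (F_ m i) by have [] := hF m i.
pose F m := \bigcup_i F_ m i.
have mF m : measurable (F m) by apply: bigcupT_measurable.
pose e m := 2 * C * expR (- (b * (N * r ^+ 2))) * expR (cu * N * zeta m ^+ 2).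
have nuF m : D m -> (nu (F m) <= (e m)%:E)%E.
  move=> Dm; apply: le_trans (generalized_Boole_inequality _ _ _) _ => //; first exact: mF.
  have e0 : 0 <= e m by rewrite !mulr_ge0 ?expR_ge0// ltW.
  (* With x = b N r^2 the exponent at shell i is 2 x (i + 1)^2, and [shell_weight_le] brings the
     i-th term to the form [e m] / 2^(i + 1). *)
  apply: le_trans (epsilon_trick0 xpredT e0).
  apply: lee_nneseries => // i _; apply: le_trans (hF m i).2 _; rewrite lee_fin.
  have [_ sc] := hc (m, i) Dm; rewrite /= in sc.
  apply: (@le_trans _ _ (2 * expR (cu * N * zeta m ^+ 2) *
      (C * (expR (- (b * (N * r ^+ 2))) / (2 ^ i.+1)%:R)))); last first.
    by rewrite /e le_eqVlt; apply/orP; left; apply/eqP; ring.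
  apply: ler_pM => //; first by rewrite mulr_ge0 ?expR_ge0 ?(ltW C0).
  rewrite ler_wpM2l ?(ltW C0)//.
  have := shell_weight_le _ i bX; rewrite /z exprMn.
  by congr (expR (- _) <= _); ring.
have mbig : measurable (\bigcup_(m in D) F m).
  rewrite bigcup_mkcond; apply: countable_bigcupT_measurable => // m.
  by case: ifP.
exists (\bigcup_(m in D) F m); split=> //.
  apply: (le_trans (measure_le_esum_bigcup _ nu D F _ mbig (fun m _ => mF m) _)) => //.
  apply: (@le_trans _ _ (\esum_(m in D) ((2 * C * expR (- (b * (N * r ^+ 2))))%:E *
      (expR (cu * N * zeta m ^+ 2))%:E))%E).
    by apply: le_esum => m Dm; rewrite -EFinM; exact: nuF.
  have k0 : 0 <= 2 * C * expR (- (b * (N * r ^+ 2))) by rewrite !mulr_ge0 ?expR_ge0 ?(ltW C0).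
  apply: le_trans (le_esumZl _ _ _ k0 _) _.
    by move=> m; rewrite lee_fin expR_ge0.
  by rewrite [leRHS]EFinM; apply: lee_wpmul2l; rewrite ?lee_fin.
move=> m t Dm Tht rt.
have x0 : 0 <= dist (T t) l / r by rewrite divr_ge0 ?(ltW r0)//; case: mdist.
(* The integer part of the distance divided by [r] locates the shell; it is at least 1, and the
   shell index is one less. *)
have /andP[] := truncn_itv x0; set j := Num.trunc _.
rewrite ler_pdivlMr// ltr_pdivrMr// => jl jr.
have j0 : (0 < j)%N.
  rewrite lt0n; apply/eqP => j0; move: jr; rewrite j0 mul1r => /(le_lt_trans rt).
  by rewrite ltxx.
pose i := j.-1; have ji : i.+1 = j by rewrite /i prednK.
have iz : z i <= dist (T t) l by rewrite /z ji.
have zi : dist (T t) l <= 2 * z i.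
  apply: (le_trans (ltW jr)); rewrite /z ji mulrA ler_wpM2r ?(ltW r0)//.
  by rewrite -natrM ler_nat mul2n -addnn -addn1 leq_add2l.
have [[cS ccov] _] := hc (m, i) Dm.
have [t' t'c tt'] := ccov t (conj Tht zi).
(* As u <= 1/2, the centre is within z_i / 2 of a point at distance at least z_i, so its test is not
   the trivial one. *)
have sep : z i / 2 <= dist (T t') l.
  have [_ _ _ dT] := mdist; have := dT (T t) (T t') l.
  have : u * z i <= 2^-1 * z i by rewrite ler_wpM2r// ltW.
  by rewrite /= in tt'; lra.
have [_ /(_ _ tt') err] := separated_test_errors _ mu _ _ _ _ _ _ _ _ _ _ _ _ _ mdist dq N0 rho01
    rhop1 c1c2 uc sand (ltW (z0 i)) u0 sep.
apply: (@le_trans _ _ (\int[mu]_(y in ~` [set y | (q l y <= q (T t') y)%R]) (q (T t) y)%:E)%E).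
  have [mqt qt0 _] := dq (T t).
  apply: ge0_subset_integral => //.
  - exact: measurableC.
  - apply: measurableC; have := mG i t'; by rewrite /G sep.
  - by apply/measurable_EFinP; exact: measurable_funTS.
  - by move=> y _; rewrite lee_fin ltW.
  - apply: subsetC => y qy; exists m => //; exists i => //; exists t' => //.
    by rewrite /G sep.
apply: (le_trans err); rewrite lee_fin.
have Nz : N * r ^+ 2 <= N * z i ^+ 2.
  by rewrite ler_wpM2l// lerXn2r ?nnegrE ?(ltW r0) ?(ltW (z0 i)).
have b0 : 0 <= b by rewrite /b; move: rho01 c1c2 => /andP[? ?] /andP[? ?]; nra.
apply: lerD; apply: ler_wpM2l; rewrite ?expR_ge0// ler_expR lerN2; apply: ler_wpM2l => //.
by rewrite divr_ge0// mulr_ge0// subr_ge0 ltW.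
Qed.

(** The infimum need not be attained; its positivity leaves room for the factor 2. *)
Lemma near_minimal_model {R : realType} {M : countType} (eta zeta : M -> R) (m0 : M) :
  (forall m, 0 < eta m /\ 0 < zeta m) -> 0 < min_rate eta zeta ->
  exists m, eta m + zeta m <= 2 * min_rate eta zeta.
Proof.
move=> pos e0; have hinf : has_inf [set eta m + zeta m | m in [set: M]].
  split; first by exists (eta m0 + zeta m0), m0.
  by exists 0 => _ [m _ <-]; rewrite addr_ge0//; have [/ltW ? /ltW ?] := pos m.
have [_ [m _ <-] /ltW h] := inf_adherent e0 hinf.
by exists m; move: h; rewrite /min_rate; lra.
Qed.

Lemma mixture_ge_component d {T : measurableType d} {R : realType} {M : countType}
    (Pi : probability T R) (alpha : M -> R) (Pim : M -> probability T R) (m : M) (B : set T) :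
  (forall m, 0 <= alpha m) -> is_mixture Pi alpha Pim -> measurable B ->
  ((alpha m)%:E * Pim m B <= Pi B)%E.
Proof.
move=> a0 mix mB; rewrite mix//; apply: esum_ge; exists [set m].
  by split.
by rewrite fsbig_set1.
Qed.

(** Components in [D] live on sets that [A] avoids and give it no mass; the others give it at most
    1. *)
Lemma mixture_setC_components_le d {T : measurableType d} {R : realType} {M : countType}
    (Pi : probability T R) (alpha : M -> R) (Pim : M -> probability T R)
    (Theta : M -> set T) (D : set M) (A : set T) :
  (forall m, 0 <= alpha m) -> is_mixture Pi alpha Pim -> measurable A ->
  (forall m, measurable (Theta m)) -> (forall m, Pim m (Theta m) = 1%E) ->
  (forall m, D m -> A `<=` ~` Theta m) ->
  (Pi A <= \esum_(m in ~` D) (alpha m)%:E)%E.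
Proof.
move=> a0 mix mA mTh PTh AD; rewrite mix// [leRHS]esum_mkcond.
apply: le_esum => m _; case: ifPn => [_|].
  by rewrite -[leRHS]mule1 lee_wpmul2l// ?lee_fin// probability_le1.
rewrite in_setC negbK inE => Dm; suff -> : Pim m A = 0%E by rewrite mule0.
apply/eqP; rewrite -measure_le0; apply: (@le_trans _ _ (Pim m (~` Theta m))).
  by apply: le_measure; rewrite ?inE//; [exact: measurableC|exact: AD].
by rewrite probability_setC// PTh subee.
Qed.

Section prior_weights.
Context {R : realType} {M : countType} (eta zeta alpha : M -> R).
Context (N c b0 Ln k1 k2 k3 : R).
Local Notation eps := (min_rate eta zeta).
Hypothesis (pos : forall m, 0 < eta m /\ 0 < zeta m) (eps0 : 0 < eps) (N0 : 0 <= N).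
Hypothesis (pv : probvec alpha) (c0 : 0 < c) (b0_gt0 : 0 < b0) (Ln1 : 1 <= Ln).
Hypothesis (k10 : 0 < k1) (k20 : 0 < k2) (k30 : 0 < k3).
Hypothesis alphaE : forall m, alpha m = c * expR (- (b0 * Ln * N * zeta m ^+ 2)).
Hypothesis sums : forall H' L' L'' : R, 1 < H' -> 0 < L' -> 0 < L'' ->
  (\esum_(m in [set m | (H' * eps <= zeta m)%R]) (expR (- (L' * N * zeta m ^+ 2)))%:E
    <= (expR ((k1 - L' * H' ^+ 2) * N * eps ^+ 2))%:E)%E /\
  (\esum_(m in [set m | (zeta m < H' * eps)%R]) (expR (L'' * N * zeta m ^+ 2))%:E
    <= (expR ((k2 + k3 * L'' * H' ^+ 2) * N * eps ^+ 2))%:E)%E.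

(** The first sum of (C) with L' = b0 Ln, which is exactly the exponent of the prior weights. *)
Lemma complex_models_weight (H : R) : 1 < H ->
  (\esum_(m in [set m | (H * eps <= zeta m)%R]) (alpha m)%:E <=
    (c * expR ((k1 - b0 * Ln * H ^+ 2) * N * eps ^+ 2))%:E)%E.
Proof.
move=> H1; have bL0 : 0 < b0 * Ln by rewrite mulr_gt0// (lt_le_trans ltr01).
apply: (@le_trans _ _ (\esum_(m in [set m | (H * eps <= zeta m)%R])
    (c%:E * (expR (- (b0 * Ln * N * zeta m ^+ 2)))%:E))%E).
  by apply: le_esum => m _; rewrite alphaE EFinM.
apply: le_trans (le_esumZl _ _ _ (ltW c0) _) _; first by move=> m; rewrite lee_fin expR_ge0.
rewrite [leRHS]EFinM; apply: lee_wpmul2l; first by rewrite lee_fin ltW.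
exact: (sums H (b0 * Ln) 1 H1 bL0 ltr01).1.
Qed.

(** The weight of one model of small [zeta] is at most 1, which already limits the normalizing
    constant. *)
Lemma prior_constant_le (m : M) : zeta m <= 2 * eps ->
  c <= expR (4 * b0 * Ln * (N * eps ^+ 2)).
Proof.
move=> zm; have am1 : alpha m <= 1.
  case: pv => a0 sa; rewrite -lee_fin -sa; apply: esum_ge; exists [set m]; first by split.
  by rewrite fsbig_set1.
have zz : zeta m ^+ 2 <= 4 * eps ^+ 2 by have [_ ?] := pos m; nra.
have : c = alpha m * expR (b0 * Ln * N * zeta m ^+ 2).
  by rewrite alphaE -mulrA -expRD addNr expR0 mulr1.
move=> ->; apply: (@le_trans _ _ (expR (b0 * Ln * N * zeta m ^+ 2))).
  by rewrite -[leRHS]mul1r ler_wpM2r// expR_ge0.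
rewrite ler_expR.
have : b0 * Ln * N * zeta m ^+ 2 <= b0 * Ln * N * (4 * eps ^+ 2).
  by rewrite ler_wpM2l// !mulr_ge0 ?(ltW b0_gt0)// (le_trans ler01).
by lra.
Qed.

(** The weights sum to 1 and are split at zeta = 2 eps. Both parts are bounded through (C) with H' =
    2; in the small part the exponential of the weight is bounded by 1 and then by e^(N zeta^2), so
    that the exponent is free of [Ln]. *)
Lemma prior_constant_ge : 1 <= c * (2 * expR ((k1 + k2 + 4 * k3) * (N * eps ^+ 2))).
Proof.
have [a0 sa] := pv; have E0 : 0 <= N * eps ^+ 2 by rewrite mulr_ge0// exprn_ge0// ltW.
have bL0 : 0 < b0 * Ln by rewrite mulr_gt0// (lt_le_trans ltr01).
have lt12 : 1 < 2 :> R by rewrite ltr1n.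
pose Z := expR ((k1 + k2 + 4 * k3) * (N * eps ^+ 2)).
have cZ0 : 0 <= c * Z by rewrite mulr_ge0 ?expR_ge0 ?(ltW c0).
have big_le : (\esum_(m in [set m | (2 * eps <= zeta m)%R]) (alpha m)%:E <= (c * Z)%:E)%E.
  apply: (le_trans (complex_models_weight 2 lt12)).
  rewrite lee_fin ler_wpM2l ?(ltW c0)// ler_expR -mulrA ler_wpM2r//.
  by move: (bL0) (k20) (k30); lra.
have small_le : (\esum_(m in [set m | (zeta m < 2 * eps)%R]) (alpha m)%:E <= (c * Z)%:E)%E.
  apply: (@le_trans _ _ (\esum_(m in [set m | (zeta m < 2 * eps)%R])
      (c%:E * (expR (1 * N * zeta m ^+ 2))%:E))%E).
    apply: le_esum => m _; rewrite alphaE -EFinM lee_fin ler_wpM2l ?(ltW c0)// ler_expR.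
    apply: (@le_trans _ _ 0); last by rewrite mul1r mulr_ge0// exprn_even_ge0.
    by rewrite oppr_le0 mulr_ge0 ?exprn_even_ge0// mulr_ge0 ?(ltW bL0).
  apply: le_trans (le_esumZl _ _ _ (ltW c0) _) _; first by move=> m; rewrite lee_fin expR_ge0.
  rewrite [leRHS]EFinM; apply: lee_wpmul2l; first by rewrite lee_fin ltW.
  apply: (le_trans (sums 2 1 1 lt12 ltr01 ltr01).2).
  by rewrite lee_fin ler_expR -mulrA ler_wpM2r//; move: (k10); lra.
have : (1 <= (c * Z)%:E + (c * Z)%:E)%E.
  rewrite -[leLHS]sa (esumID [set m | (2 * eps <= zeta m)%R]); last by move=> m _; rewrite lee_fin.
  rewrite !setTI; apply: leeD => //.
  rewrite (_ : ~` _ = [set m | (zeta m < 2 * eps)%R])//.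
  by apply/seteqP; split=> m /=; rewrite ltNge => /negP.
by rewrite -EFinD lee_fin /Z; lra.
Qed.
End prior_weights.

(** * Rates *)

(** Half of the test exponent absorbs the entropy of the models below the threshold, the other half
    absorbs k2 E and leaves e^(-E). *)
Lemma type_one_rate {R : realType} (A Ln E b k2 k3 cu h : R) :
  0 <= E -> 1 <= Ln -> 0 <= b -> k3 * cu * h ^+ 2 <= b / 2 -> k2 + 1 <= b / 2 * A ^+ 2 ->
  expR (- (b * (A ^+ 2 * Ln * E))) * expR ((k2 + k3 * cu * (h * A) ^+ 2) * E) <= expR (- E).
Proof.
move=> E0 Ln1 b0 hb kA; rewrite -expRD ler_expR exprMn.
have P0 : 0 <= A ^+ 2 * E by rewrite mulr_ge0// exprn_even_ge0.
have := ler_wpM2r P0 hb; have := ler_wpM2r E0 kA.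
have := ler_wpM2l (mulr_ge0 b0 P0) Ln1.
by lra.
Qed.

(** The factor e^s uses half of the decay e^(-g X). The lower bound on g A^2 / 2 lets the other half
    beat all exponents of order Ln E: those of the evidence level, of 1 / [pi] and of the prior
    constant. *)
Lemma posterior_term_rate {R : realType} (A Ln E g h b b' b0 c2 a2 k1 C1 C2 C3 cD cE cn pi X s :
    R) :
  1 <= E -> 1 <= Ln -> 1 <= A -> 0 < g -> g <= b -> g <= b' -> g <= b0 * h ^+ 2 ->
  0 <= C1 -> 0 <= C2 -> 0 <= C3 -> 0 <= c2 -> 0 < b0 -> 0 <= k1 -> 0 <= cD -> 0 <= cE -> 0 < cn ->
  5 * c2 + (C3 + 4 * b0 + 4 * cD) + (4 * b0 + k1) <= g / 2 * A ^+ 2 ->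
  1 <= cn * (2 * expR (C3 * E)) -> cn <= expR (4 * b0 * Ln * E) ->
  cn * expR (- (4 * b0 * Ln * E)) * expR (- (4 * cD * E)) <= pi ->
  X = A ^+ 2 * Ln * E -> s = g / 2 * X ->
  (cE * Ln * E + expR s * (2 * expR (a2 + 5 * c2 * E) / pi) *
     (C1 * expR (- (b * X)) + C2 * expR (- (b' * X)) +
      cn * expR ((k1 - b0 * Ln * (h * A) ^+ 2) * E))) / s
  <= 2 * (cE + 4 * expR a2 * (C1 + C2 + 1)) / (g * A ^+ 2).
Proof.
move=> E1 Ln1 A1 g0 gb gb' gh C10 C20 C30 c20 b00 k10 cD0 cE0 cn0 CA cn1 cnle pile XE sE.
have E0 : 0 <= E by lra.
have LE : 1 <= Ln * E by nra.
have LEE : E <= Ln * E by nra.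
have A20 : 0 < A ^+ 2 by rewrite exprn_gt0// (lt_le_trans ltr01).
have X0 : 0 < X by rewrite XE !mulr_gt0//; lra.
have s0 : 0 < s by rewrite sE mulr_gt0// divr_gt0.
have pi0 : 0 < pi by apply: lt_le_trans pile; rewrite !mulr_gt0 ?expR_gt0.
(* The lower bound on [pi] contains [cn], which [cn1] bounds from below. *)
have ipi : pi^-1 <= 2 * expR ((C3 + 4 * b0 + 4 * cD) * (Ln * E)).
  rewrite -[leLHS]mul1r ler_pdivrMr//.
  apply: (@le_trans _ _ (2 * expR ((C3 + 4 * b0 + 4 * cD) * (Ln * E)) *
      (cn * expR (- (4 * b0 * Ln * E)) * expR (- (4 * cD * E))))); last first.
    by rewrite ler_wpM2l// mulr_ge0 ?expR_ge0.
  apply: (le_trans cn1).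
  rewrite (_ : 2 * _ * _ = cn * (2 * (expR ((C3 + 4 * b0 + 4 * cD) * (Ln * E)) *
    expR (- (4 * b0 * Ln * E)) * expR (- (4 * cD * E))))); last by ring.
  rewrite ler_wpM2l ?(ltW cn0)// ler_wpM2l// -!expRD ler_expR.
  have := ler_wpM2l C30 LEE; have := ler_wpM2l cD0 LEE; lra.
have eUB : C1 * expR (- (b * X)) + C2 * expR (- (b' * X)) +
    cn * expR ((k1 - b0 * Ln * (h * A) ^+ 2) * E) <=
    (C1 + C2 + 1) * expR ((4 * b0 + k1) * (Ln * E) - g * X).
  have le0 : 0 <= (4 * b0 + k1) * (Ln * E) by rewrite !mulr_ge0//; lra.
  rewrite [leRHS](_ : _ = C1 * expR ((4 * b0 + k1) * (Ln * E) - g * X) +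
    C2 * expR ((4 * b0 + k1) * (Ln * E) - g * X) +
    expR ((4 * b0 + k1) * (Ln * E) - g * X)); last by ring.
  apply: lerD; first apply: lerD.
  - rewrite ler_wpM2l// ler_expR; have := ler_wpM2r (ltW X0) gb; lra.
  - rewrite ler_wpM2l// ler_expR; have := ler_wpM2r (ltW X0) gb'; lra.
  - apply: (@le_trans _ _ (expR (4 * b0 * Ln * E) * expR ((k1 - b0 * Ln * (h * A) ^+ 2) * E))).
      by rewrite ler_wpM2r// expR_ge0.
    rewrite -expRD ler_expR exprMn.
    by have := ler_wpM2r (ltW X0) gh; have := ler_wpM2l k10 LEE; rewrite XE; lra.
have main : expR s * (2 * expR (a2 + 5 * c2 * E) / pi) *
     (C1 * expR (- (b * X)) + C2 * expR (- (b' * X)) +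
      cn * expR ((k1 - b0 * Ln * (h * A) ^+ 2) * E)) <= 4 * expR a2 * (C1 + C2 + 1).
  apply: (@le_trans _ _ (expR s * (2 * expR (a2 + 5 * c2 * E) *
      (2 * expR ((C3 + 4 * b0 + 4 * cD) * (Ln * E)))) *
      ((C1 + C2 + 1) * expR ((4 * b0 + k1) * (Ln * E) - g * X)))).
    apply: ler_pM => //.
    - by rewrite !mulr_ge0 ?expR_ge0 ?invr_ge0 ?(ltW pi0).
    - by rewrite !addr_ge0// mulr_ge0 ?expR_ge0 ?(ltW cn0).
    - by rewrite ler_wpM2l ?expR_ge0// ler_wpM2l// mulr_ge0 ?expR_ge0.
  rewrite expRD (_ : _ * _ = 4 * expR a2 * (C1 + C2 + 1) * (expR s * expR (5 * c2 * E) *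
    expR ((C3 + 4 * b0 + 4 * cD) * (Ln * E)) * expR ((4 * b0 + k1) * (Ln * E) - g * X)));
    last by ring.
  rewrite -[leRHS]mulr1 ler_wpM2l//; first by rewrite !mulr_ge0 ?expR_ge0//; lra.
  rewrite -!expRD -[leRHS](@expR0 R) ler_expR sE XE.
  have := ler_wpM2l c20 LEE; have := ler_wpM2r (le_trans ler01 LE) CA; lra.
(* As Ln E >= 1, the constant is absorbed into a multiple of Ln E; dividing by s = g A^2 Ln E / 2
   leaves the factor 1 / A^2. *)
rewrite ler_pdivrMr//; apply: (@le_trans _ _ ((cE + 4 * expR a2 * (C1 + C2 + 1)) * (Ln * E))).
  rewrite [leRHS]mulrDl [cE * (Ln * E)]mulrA; apply: lerD => //; apply: (le_trans main).
  by rewrite ler_peMr// !mulr_ge0 ?expR_ge0//; lra.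
rewrite le_eqVlt; apply/orP; left; apply/eqP; rewrite sE XE.
by field; rewrite (gt_eqF g0) (gt_eqF (lt_le_trans ltr01 A1)).
Qed.

(* h A eps is the threshold on zeta separating the models handled by the tests from
   those handled by their prior mass; g bounds below all exponential rates in X,
   and the Donsker-Varadhan parameter is s = g X / 2. *)
Lemma variational_risk_rate d {Y : measurableType d} {R : realType}
    (mu : {measure set Y -> \bar R}) {Lam : Type} (dist : Lam -> Lam -> R)
    (q : Lam -> Y -> R) {M : countType} d' {Th : measurableType d'} (Theta : M -> set Th)
    (T : Th -> Lam) (alpha : M -> R) (Pim : M -> probability Th R) (Pi : probability Th R)
    (post Xi : Y -> probability Th R) (I : Y -> \bar R) (eta zeta : M -> R) (l : Lam)
    (N A Ln b0 rho0 rhop a1 a2 c1 c2 u cu k1 k2 k3 cD cE cn h g : R) :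
  let eps := min_rate eta zeta in
  let E := N * eps ^+ 2 in
  let b := (1 - rho0) * c1 / 8 in
  let b' := (rhop - 1) * b / 2 in
  let C1 := expR (- ((1 - rho0) * a1)) in
  let C2 := expR ((rhop - 1) * a2) in
  sigma_finite setT mu -> is_metric dist -> (forall l, is_pos_density mu (q l)) ->
  measurable_fun setT (fun p : Th * Y => q (T p.1) p.2) ->
  measurable_fun setT (fun t => dist (T t) l) ->
  (forall m, measurable (Theta m)) -> (forall m, Pim m (Theta m) = 1%E) ->
  is_mixture Pi alpha Pim ->
  (forall y A, measurable A -> post y A = \int[Pi]_(t in A) (q (T t) y)%:E
     * ((fine (\int[Pi]_t (q (T t) y)%:E))^-1)%:E)%E ->
  (forall A, measurable A -> measurable_fun setT (fun y => Xi y A)) ->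
  measurable_fun setT I -> (forall y, KL (Xi y) (post y) <= I y)%E ->
  0 < rho0 < 1 -> 1 < rhop -> 0 < c1 <= c2 ->
  renyi_sandwich mu dist q N rho0 rhop a1 a2 c1 c2 ->
  16 * (c2 * u ^+ 2) <= (1 - rho0) * c1 -> 0 <= u <= 2^-1 ->
  (forall m, 0 < eta m /\ 0 < zeta m) ->
  (forall m z, (zeta m < z)%R -> log_covering_number dist T (u * z)
     [set t | Theta m t /\ (dist (T t) l <= 2 * z)%R] <= (cu * N * zeta m ^+ 2)%:E)%E ->
  (forall H' L' L'' : R, 1 < H' -> 0 < L' -> 0 < L'' ->
    (\esum_(m in [set m | (H' * eps <= zeta m)%R]) (expR (- (L' * N * zeta m ^+ 2)))%:E
      <= (expR ((k1 - L' * H' ^+ 2) * N * eps ^+ 2))%:E)%E /\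
    (\esum_(m in [set m | (zeta m < H' * eps)%R]) (expR (L'' * N * zeta m ^+ 2))%:E
      <= (expR ((k2 + k3 * L'' * H' ^+ 2) * N * eps ^+ 2))%:E)%E) ->
  0 < k1 -> 0 < k2 -> 0 < k3 -> 0 < cu -> 0 < cD -> 0 < cE -> 0 < cn -> 0 < b0 -> 1 <= Ln ->
  probvec alpha -> (forall m, alpha m = cn * expR (- (b0 * Ln * N * zeta m ^+ 2))) ->
  (forall m, (expR (- (cD * N * zeta m ^+ 2)))%:E
     <= Pim m [set t | (dist (T t) l <= eta m + zeta m)%R])%E ->
  (\int[mu]_y (I y * (q l y)%:E) <= (cE * Ln * N * eps ^+ 2)%:E)%E ->
  0 <= N -> 0 < eps -> 1 <= E -> 1 <= A -> 0 < h <= 1 -> 1 < h * A ->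
  0 < g -> g <= b -> g <= b' -> g <= b0 * h ^+ 2 -> k3 * cu * h ^+ 2 <= b / 2 ->
  1 <= b * A ^+ 2 -> k2 + 1 <= b / 2 * A ^+ 2 ->
  5 * c2 + (k1 + k2 + 4 * k3 + 4 * b0 + 4 * cD) + (4 * b0 + k1) <= g / 2 * A ^+ 2 ->
  (\int[mu]_y (Xi y [set t | (A * Num.sqrt Ln * eps <= dist (T t) l)%R] * (q l y)%:E)
    <= (2 * C1 * expR (- E) + 2 * expR (- ((rhop - 1) * c2 * E)) +
        2 * (cE + 4 * expR a2 * (C1 + C2 + 1)) / (g * A ^+ 2))%:E)%E.
Proof.
move=> eps E b b' C1 C2 sf mdist dq mq mdT mTh PTh mix Hpost mXi mI KLI rho01 rhop1 c12 sand
  uc u01 pos ent sums k10 k20 k30 cu0 cD0 cE0 cn0 b00 Ln1 pv alphaE mass IE N0 eps0 E1 A1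
  /andP[h0 h1] hA g0 gb gb' gh khb bA kA CA.
have [a0 sa] := pv.
have Ln0 : 0 < Ln := lt_le_trans ltr01 Ln1.
have A0 : 0 < A := lt_le_trans ltr01 A1.
have E0 : 0 <= E := le_trans ler01 E1.
have /andP[c10 c1c2] := c12; have c20 : 0 < c2 := lt_le_trans c10 c1c2.
have b_0 : 0 < b := lt_le_trans g0 gb.
pose r := A * Num.sqrt Ln * eps.
have r0 : 0 < r by rewrite !mulr_gt0// sqrtr_gt0.
pose X := A ^+ 2 * Ln * E.
have NrX : N * r ^+ 2 = X by rewrite /r !exprMn sqr_sqrtr ?(ltW Ln0)// /X /E; ring.
(* Because h <= 1 and Ln >= 1, every model in [D] has [zeta] below [r], so its entropy bound holds
   at all shells. *)
pose D := [set m | (zeta m < h * A * eps)%R].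
have Dr m : D m -> zeta m < r.
  move=> /lt_le_trans; apply; rewrite /r ler_wpM2r ?(ltW eps0)//.
  apply: (@le_trans _ _ A); first by rewrite ler_piMl// ltW.
  by rewrite ler_peMr ?(ltW A0)// -[leLHS]sqrtr1 ler_wsqrtr.
have bX : 1 <= b * (N * r ^+ 2).
  rewrite NrX /X; have : 1 <= Ln * E by nra.
  by move: bA; nra.
have [F [mF F1 F2]] := sieve_test _ mu dist q T Theta zeta D N rho0 rhop a1 a2 c1 c2 u cu r
  _ l mdist dq N0 rho01 rhop1 c12 uc u01 sand r0 Dr (fun m _ z => ent m z)
  (sums (h * A) 1 cu hA ltr01 cu0).2 bX.
pose B := [set t | (dist (T t) l <= 2 * eps)%R].
pose U := [set t | (r <= dist (T t) l)%R].
pose U' := U `&` \bigcup_(m in D) Theta m.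
have mB : measurable B by rewrite -[B]setTI; apply: measurable_fun_le.
have mU : measurable U by rewrite -[U]setTI; apply: measurable_fun_le.
have mU' : measurable U'.
  apply: measurableI => //; rewrite bigcup_mkcond; apply: countable_bigcupT_measurable => // m.
  by case: ifP.
have [m0 _] : exists m0 : M, True.
  have [//|nM] := pselect (exists m0 : M, True).
  move: sa; rewrite (_ : [set: M] = set0) ?esum_set0; last first.
    by rewrite -subset0 => m _; apply: nM; exists m.
  by case=> /eqP; rewrite eq_sym oner_eq0.
(* For this model the ball of radius eta + zeta in (D) is contained in [B]. *)
have [m m2] := near_minimal_model eta zeta m0 pos eps0.
have [eta_m zeta_m] := pos m.
have zm2 : zeta m <= 2 * eps by apply: le_trans m2; rewrite lerDr ltW.
have cnle := prior_constant_le eta zeta alpha N cn b0 Ln pos N0 pv b00 Ln1 alphaE m zm2.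
have cnge := prior_constant_ge eta zeta alpha N cn b0 Ln k1 k2 k3 eps0 N0 pv cn0 b00 Ln1
  k10 k20 k30 alphaE sums.
have PB1 : (Pi B <= 1)%E := probability_le1 _ mB.
have PBE : Pi B = (fine (Pi B))%:E.
  by rewrite fineK// ge0_fin_numE// (le_lt_trans PB1)// ltry.
have PBge : cn * expR (- (4 * b0 * Ln * E)) * expR (- (4 * cD * E)) <= fine (Pi B).
  rewrite -lee_fin -PBE; apply: le_trans (mixture_ge_component _ _ _ _ m B a0 mix mB).
  have zz : N * zeta m ^+ 2 <= 4 * E.
    rewrite /E [leRHS]mulrCA; apply: ler_wpM2l => //; nra.
  apply: (@le_trans _ _ ((alpha m)%:E * (expR (- (cD * N * zeta m ^+ 2)))%:E)%E).
    rewrite -EFinM lee_fin alphaE; apply: ler_pM; rewrite ?mulr_ge0 ?expR_ge0 ?(ltW cn0)//.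
      rewrite ler_wpM2l ?(ltW cn0)// ler_expR lerN2 -mulrA.
      by have := ler_wpM2l (ltW (mulr_gt0 b00 Ln0)) zz; lra.
    by rewrite ler_expR lerN2 -mulrA; have := ler_wpM2l (ltW cD0) zz; lra.
  apply: lee_wpmul2l; first by rewrite lee_fin.
  apply: (le_trans (mass m)); apply: le_measure; rewrite ?inE//.
    rewrite -[X in measurable X]setTI; exact: measurable_fun_le.
  by move=> t /= /le_trans; apply.
have PB0 : 0 < fine (Pi B).
  by apply: lt_le_trans PBge; rewrite !mulr_gt0 ?expR_gt0.
have renB t : B t -> (renyi mu rhop (q l) (q (T t)) <= (a2 + 4 * c2 * E)%:E)%E.
  move=> Bt; apply: (le_trans (sand l (T t)).2); rewrite lee_fin lerD2l.
  have [d0 _ dC _] := mdist; rewrite dC -2!mulrA; move: (d0 (T t) l) => dl.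
  rewrite [leRHS](_ : _ = c2 * (N * (4 * eps ^+ 2))); last by rewrite /E; ring.
  rewrite ler_wpM2l ?(ltW c20)// ler_wpM2l//.
  by move: Bt; rewrite /B /=; nra.
(* The divergence on [B] is at most a2 + 4 c2 E; the surplus c2 E makes the bad evidence event have
   probability at most 2 e^(-(rhop - 1) c2 E). *)
pose K := expR (a2 + 5 * c2 * E).
pose eU := C1 * expR (- (b * X)) + C2 * expR (- (b' * X)).
have eU0 : 0 <= eU by rewrite addr_ge0// mulr_ge0 ?expR_ge0.
have U'eU t : U' t -> (\int[mu]_(y in ~` F) (q (T t) y)%:E <= eU%:E)%E.
  by move=> [Ut [m' Dm' Tht]]; have := F2 m' t Dm' Tht Ut; rewrite NrX.
have UU' : (Pi (U `\` U') <= (cn * expR ((k1 - b0 * Ln * (h * A) ^+ 2) * E))%:E)%E.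
  apply: le_trans (mixture_setC_components_le _ _ _ Pim Theta D _ a0 mix _ mTh PTh _) _.
  - exact: measurableD.
  - by move=> m' Dm' t [Ut nU't] Tht; apply: nU't; split=> //; exists m'.
  have := complex_models_weight eta zeta alpha N cn b0 Ln k1 k2 k3 cn0 b00 Ln1 alphaE sums _ hA.
  rewrite -[_ * N * _]mulrA => CW; apply: le_trans CW.
  rewrite (_ : ~` D = [set m | (h * A * eps <= zeta m)%R])//.
  by apply/seteqP; split=> m' /=; rewrite leNgt => /negP.
pose s := g / 2 * X.
have E_0 : 0 < E := lt_le_trans ltr01 E1.
have X0 : 0 < X := mulr_gt0 (mulr_gt0 (exprn_gt0 2 A0) Ln0) E_0.
have s0 : 0 < s := mulr_gt0 (divr_gt0 g0 (ltr0n R 2)) X0.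
apply: le_trans (variational_risk_bound _ _ Pi mu post Xi I (q l) (fun t => q (T t)) U U' B F
  K (fine (Pi B)) _ rhop s _ eU _ _ sf mU mU' mB mF (dq l) (fun t => dq (T t)) mq Hpost
  (mXi U mU) mI KLI rhop1 (expR_gt0 _) PB0 PBE renB F1 eU0 U'eU UU' IE s0) _.
rewrite lee_fin; apply: lerD; first apply: lerD.
- rewrite NrX -!mulrA ler_wpM2l// ler_wpM2l ?expR_ge0//.
  have := type_one_rate A Ln E b k2 k3 cu h E0 Ln1 (ltW b_0) khb kA.
  by rewrite /X /E !mulrA.
- rewrite /K expR_powR -mulrA ler_wpM2l// -expRD ler_expR.
  by clear; lra.
rewrite -[cE * Ln * N * _]mulrA.
by apply: (posterior_term_rate A Ln E g h b b' b0 c2 a2 k1 C1 C2 (k1 + k2 + 4 * k3) cD cE cn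
  (fine (Pi B)) X s) => //; rewrite ?expR_ge0 ?addr_ge0 ?mulr_ge0 ?ltW//; lra.
Qed.

Lemma expRN_le_inv {R : realType} (x : R) : 0 < x -> expR (- x) <= x^-1.
Proof.
move=> x0; rewrite expRN lef_pV2 ?posrE ?expR_gt0//.
by apply: le_trans (expR_ge1Dx x); rewrite lerDr.
Qed.

Lemma min_rate_ge0 {R : realType} {M : countType} (eta zeta : M -> R) :
  (forall m, 0 < eta m /\ 0 < zeta m) -> 0 <= min_rate eta zeta.
Proof.
move=> pos; rewrite /min_rate; set S := [set _ | _ in _].
have [->|/set0P S0] := eqVneq S set0; first by rewrite inf0.
by apply: lb_le_inf => // _ [m _ <-]; have [/ltW ? /ltW ?] := pos m; rewrite addr_ge0.
Qed.

Theorem theorem3p6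
  (R : realType)
  (* data spaces Y_n with sigma-finite dominating measures mu_n *)
  (dY : nat -> measure_display) (Y : forall n, measurableType (dY n))
  (mu : forall n, {measure set (Y n) -> \bar R})
  (* natural parameter spaces Lambda_n with metrics d_n; likelihoods q_n *)
  (Lam : nat -> Type) (dist : forall n, Lam n -> Lam n -> R)
  (q : forall n, Lam n -> Y n -> R)
  (* countable model index sets M_n; parameter spaces Theta_{n,m} inside an
     ambient measurable space Th n; the map T_n *)
  (M : nat -> countType)
  (dT : nat -> measure_display) (Th : forall n, measurableType (dT n))
  (Theta : forall n, M n -> set (Th n))
  (T : forall n, Th n -> Lam n)
  (* prior, posterior, variational family and variational posterior *)
  (alpha : forall n, M n -> R)
  (Pim : forall n, M n -> probability (Th n) R)
  (Pi : forall n, probability (Th n) R)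
  (post : forall n, Y n -> probability (Th n) R)
  (V : forall n, M n -> set (probability (Th n) R))
  (Xihat : forall n, Y n -> probability (Th n) R)
  (* true parameter spaces, rates, and prior constants *)
  (Lstar : forall n, set (Lam n))
  (eta zeta : forall n, M n -> R)
  (L : nat -> R) (b0 : R)
  (* ---------- standing setting ---------- *)
  (Hmu : forall n, sigma_finite setT (mu n))
  (Hdist : forall n, is_metric (dist n))
  (Hq : forall n l, is_pos_density (mu n) (q n l))
  (HqT : forall n, measurable_fun setT (fun p : Th n * Y n => q n (T n p.1) p.2))
  (HdT : forall n l, measurable_fun setT (fun t => dist n (T n t) l))
  (HTheta : forall n m, measurable (Theta n m))
  (HPim : forall n m, Pim n m (Theta n m) = 1%E)
  (HPi : forall n, is_mixture (Pi n) (alpha n) (Pim n))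
  (Hpost : forall n y A, measurable A ->
     post n y A =
       (\int[Pi n]_(t in A) (q n (T n t) y)%:E
        * ((fine (\int[Pi n]_t (q n (T n t) y)%:E))^-1)%:E)%E)
  (HV : forall n m Xi, V n m Xi -> Xi (Theta n m) = 1%E)
  (HXihat : forall n y,
     in_mixture_family (V n) (Xihat n y) /\
     forall Xi, in_mixture_family (V n) Xi ->
       (KL (Xihat n y) (post n y) <= KL Xi (post n y))%E)
  (HXihat_meas : forall n A, measurable A ->
     measurable_fun setT (fun y => Xihat n y A))
  (HinfKL_meas : forall n, measurable_fun setT
     (fun y => ereal_inf [set KL Xi (post n y) | Xi in in_mixture_family (V n)]))
  (* ---------- (A) ---------- *)
  (HA : exists rho0 rhop a1 a2 c1 c2 : R,
     [/\ 0 < rho0 < 1, 1 < rhop, a1 <= a2, 0 < c1 <= c2 &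
      exists N, forall n, (N <= n)%N -> forall l0 l1 : Lam n,
        ((a1 + c1 * n%:R * dist n l0 l1 ^+ 2)%:E
           <= renyi (mu n) rho0 (q n l0) (q n l1))%E /\
        (renyi (mu n) rhop (q n l0) (q n l1)
           <= (a2 + c2 * n%:R * dist n l0 l1 ^+ 2)%:E)%E])
  (* ---------- (B) ---------- *)
  (HBpos : forall n m, 0 < eta n m /\ 0 < zeta n m)
  (HBapprox : forall n l, Lstar n l -> forall m,
     exists2 t, Theta n m t & dist n (T n t) l <= eta n m)
  (HBentropy : forall u : R, 0 < u -> exists cu : R, exists N, forall n, (N <= n)%N ->
     forall l, Lstar n l -> forall m, forall z, zeta n m < z ->
       (log_covering_number (dist n) (T n) (u * z)
          [set t | Theta n m t /\ (dist n (T n t) l <= 2 * z)%R]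
        <= (cu * n%:R * zeta n m ^+ 2)%:E)%E)
  (* ---------- (C) ---------- *)
  (HCdiv : (n%:R * min_rate (eta n) (zeta n) ^+ 2) @[n --> \oo] --> +oo)
  (HCsum : exists k1 k2 k3 : R, [/\ 0 < k1, 0 < k2, 0 < k3 &
     exists N, forall n, (N <= n)%N -> forall H' L' L'' : R,
       1 < H' -> 0 < L' -> 0 < L'' ->
       (\esum_(m in [set m | (H' * min_rate (eta n) (zeta n) <= zeta n m)%R])
           (expR (- (L' * n%:R * zeta n m ^+ 2)))%:E
         <= (expR ((k1 - L' * H' ^+ 2) * n%:R * min_rate (eta n) (zeta n) ^+ 2))%:E)%E /\
       (\esum_(m in [set m | (zeta n m < H' * min_rate (eta n) (zeta n))%R])
           (expR (L'' * n%:R * zeta n m ^+ 2))%:E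
         <= (expR ((k2 + k3 * L'' * H' ^+ 2) * n%:R
                   * min_rate (eta n) (zeta n) ^+ 2))%:E)%E])
  (* ---------- (D) ---------- *)
  (Hb0 : 0 < b0)
  (HL : forall n, 1 <= L n)
  (Halpha : forall n, probvec (alpha n) /\
     exists2 cn, 0 < cn &
       forall m, alpha n m = cn * expR (- (b0 * L n * n%:R * zeta n m ^+ 2)))
  (HDmass : exists2 c : R, 0 < c & exists N, forall n, (N <= n)%N ->
     forall l, Lstar n l -> forall m,
       ((expR (- (c * n%:R * zeta n m ^+ 2)))%:E
          <= Pim n m [set t | (dist n (T n t) l <= eta n m + zeta n m)%R])%E)
  (* ---------- (E) ---------- *)
  (HE : exists2 c : R, 0 < c & exists N, forall n, (N <= n)%N ->
     forall l, Lstar n l ->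
       (expect (mu n) (q n l)
          (fun y => ereal_inf [set KL Xi (post n y) | Xi in in_mixture_family (V n)])
        <= (c * L n * n%:R * min_rate (eta n) (zeta n) ^+ 2)%:E)%E) :
  (* ---------- conclusion ---------- *)
  forall An : nat -> R, An n @[n --> \oo] --> +oo ->
  forall e : R, 0 < e -> exists N, forall n, (N <= n)%N ->
    forall l, Lstar n l ->
      (expect (mu n) (q n l)
         (fun y => Xihat n y
            [set t | (An n * Num.sqrt (L n) * min_rate (eta n) (zeta n)
                     <= dist n (T n t) l)%R])
       <= e%:E)%E.
Proof.
move=> An HAn e e0.
have [rho0 [rhop [a1 [a2 [c1 [c2 [rho01 rhop1 _ c12 [NA sandA]]]]]]]] := HA.
have [k1 [k2 [k3 [k10 k20 k30 [NC sums]]]]] := HCsum.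
have [cD cD0 [ND mass]] := HDmass.
have [cE cE0 [NE infKL]] := HE.
have /andP[c10 c1c2] := c12; have c20 : 0 < c2 := lt_le_trans c10 c1c2.
have /andP[rho00 rho01'] := rho01.
have rho10 : 0 < 1 - rho0 by rewrite subr_gt0.
have rhop10 : 0 < rhop - 1 by rewrite subr_gt0.
pose b := (1 - rho0) * c1 / 8.
have b_0 : 0 < b by rewrite divr_gt0// mulr_gt0.
pose b' := (rhop - 1) * b / 2.
have b'0 : 0 < b' by rewrite divr_gt0// mulr_gt0.
(* Chosen with 16 c2 u = (1 - rho0) c1; then u <= 1/16, and u^2 <= u gives the smallness required by
   the tests. *)
pose u := (1 - rho0) * c1 / (16 * c2).
have u0 : 0 < u by rewrite divr_gt0 ?mulr_gt0.
have u1 : u <= 16^-1.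
  by rewrite ler_pdivrMr ?mulr_gt0// mulKf ?pnatr_eq0//; nra.
have uc : 16 * (c2 * u ^+ 2) <= (1 - rho0) * c1.
  have uE : (1 - rho0) * c1 = 16 * c2 * u by rewrite [RHS]mulrC divfK// gt_eqF ?mulr_gt0.
  by rewrite uE -!mulrA ler_wpM2l// ler_wpM2l ?(ltW c20)//; nra.
have [cu' [NB ent]] := HBentropy u u0.
(* The entropy constant may be nonpositive, while it enters (C) as a positive L''. *)
pose cu := Num.max cu' 1.
have cu0 : 0 < cu by rewrite lt_max ltr01 orbT.
have kcu0 : 0 < k3 * cu by rewrite mulr_gt0.
(* This [h] lies in (0, 1], so h^2 <= h, and k3 cu h < b / 2. *)
pose h := b / (b + 2 * (k3 * cu)).
have den0 : 0 < b + 2 * (k3 * cu) by rewrite addr_gt0// mulr_gt0.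
have h0 : 0 < h by rewrite divr_gt0.
have hE : h * (b + 2 * (k3 * cu)) = b by rewrite divfK ?gt_eqF.
have h1 : h <= 1 by rewrite ler_pdivrMr// mul1r lerDl mulr_ge0// ltW.
have khb : k3 * cu * h ^+ 2 <= b / 2.
  have hb : h ^+ 2 <= h by nra.
  have := ler_wpM2l (ltW kcu0) hb; have := mulr_gt0 h0 b_0; lra.
pose g := Num.min b (Num.min b' (b0 * h ^+ 2)).
have g0 : 0 < g by rewrite !lt_min b_0 b'0 mulr_gt0// exprn_gt0.
have gb : g <= b by rewrite ge_min lexx.
have gb' : g <= b' by rewrite !ge_min lexx orbT.
have gh : g <= b0 * h ^+ 2 by rewrite !ge_min lexx !orbT.
pose C1 := expR (- ((1 - rho0) * a1)).
pose C2 := expR ((rhop - 1) * a2).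
have C10 : 0 < C1 := expR_gt0 _.
have C20 : 0 < C2 := expR_gt0 _.
pose C4 := 5 * c2 + (k1 + k2 + 4 * k3 + 4 * b0 + 4 * cD) + (4 * b0 + k1).
have C40 : 0 < C4 by rewrite /C4; lra.
pose C6 := cE + 4 * expR a2 * (C1 + C2 + 1).
have C60 : 0 < C6 by rewrite addr_gt0// !mulr_gt0 ?expR_gt0// !addr_gt0.
pose d0 := (rhop - 1) * c2.
have d00 : 0 < d0 by rewrite mulr_gt0.
(* One entry per lower bound needed on [A]. Most of these concern A^2, but A >= 1 makes linear
   conditions sufficient. The last entry makes the third error term at most e / 2. *)
pose Amin := Num.max 1 (Num.max (2 / h) (Num.max (1 / b) (Num.max ((k2 + 1) / (b / 2))
  (Num.max (C4 / (g / 2)) (4 * C6 / (g * e)))))).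
(* Through e^(-x) <= 1 / x, the last two entries make each exponential error term at most e / 4. *)
pose Emin := Num.max 1 (Num.max (8 * C1 / e) (8 / (d0 * e))).
have /cvgryPge/(_ Amin)[N1 _ HN1] := HAn.
have /cvgryPge/(_ Emin)[N2 _ HN2] := HCdiv.
exists (maxn (maxn (maxn NA NB) (maxn NC ND)) (maxn NE (maxn N1 N2))) => n.
rewrite !geq_max => /andP[/andP[/andP[nA nB] /andP[nC nD]] /andP[nE /andP[n1 n2]]] l ll.
have := HN1 n n1; rewrite /= !ge_max => /and5P[A1 hA bA kA /andP[CA eA]].
have := HN2 n n2; rewrite /= !ge_max => /and3P[E1 E2 E3].
have [pv [cn cn0 alphaE]] := Halpha n.
set eps := min_rate (eta n) (zeta n) in E1 E2 E3 *.
set A := An n in A1 hA bA kA CA eA *.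
set E := n%:R * eps ^+ 2 in E1 E2 E3.
have E0 : 0 < E := lt_le_trans ltr01 E1.
(* A vanishing rate would contradict E >= 1. *)
have eps0 : 0 < eps.
  rewrite lt_neqAle min_rate_ge0 ?andbT; last exact: HBpos.
  by apply/eqP => eps0; move: E1; rewrite /E -eps0 expr0n/= mulr0 ler10.
have A2 : A <= A ^+ 2 by rewrite expr2 ler_peMr// (le_trans ler01).
have lowerA x y : 0 < y -> x / y <= A -> x <= y * A ^+ 2.
  move=> y0; rewrite ler_pdivrMr// => /le_trans; apply.
  by rewrite mulrC ler_wpM2l ?(ltW y0).
have rate := variational_risk_rate _ (mu n) (dist n) (q n) _ (Theta n) (T n) (alpha n) (Pim n)
  (Pi n) (post n) (Xihat n)
  (fun y => ereal_inf [set KL Xi (post n y) | Xi in in_mixture_family (V n)])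
  (eta n) (zeta n) l n%:R A (L n) b0 rho0 rhop a1 a2 c1 c2 u cu k1 k2 k3 cD cE cn h g
  (Hmu n) (Hdist n) (Hq n) (HqT n) (HdT n l) (HTheta n) (HPim n) (HPi n) (Hpost n)
  (HXihat_meas n) (HinfKL_meas n).
rewrite /expect; apply: le_trans (rate _ rho01 rhop1 c12 (sandA n nA) uc _ (HBpos n) _
  (sums n nC) k10 k20 k30 cu0 cD0 cE0 cn0 Hb0 (HL n) pv alphaE (mass n nD l ll)
  (infKL n nE l ll) (ler0n _ _) eps0 E1 A1 _ _ g0 gb gb' gh khb _ _ _) _.
- move=> y; have [_ Xmin] := HXihat n y.
  by apply: le_ereal_inf_tmp => _ [Xi VXi <-]; exact: Xmin.
- by rewrite (ltW u0)/= (le_trans u1)//; clear; lra.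
- move=> m z mz; apply: (le_trans (ent n nB l ll m z mz)).
  by rewrite lee_fin ler_wpM2r ?exprn_even_ge0// ler_wpM2r// le_max lexx.
- by rewrite h0.
- by move: hA; rewrite ler_pdivrMr// mulrC; apply: lt_le_trans; rewrite ltr1n.
- exact: lowerA.
- by apply: lowerA => //; rewrite divr_gt0.
- by apply: lowerA => //; rewrite divr_gt0.
have t1 : 2 * C1 * expR (- E) <= e / 4.
  apply: (@le_trans _ _ (2 * C1 * E^-1)).
    by rewrite ler_wpM2l ?expRN_le_inv// mulr_ge0// ltW.
  rewrite ler_pdivrMr// in E2; rewrite ler_pdivrMr//.
  by clear - E2; lra.
have t2 : 2 * expR (- (d0 * E)) <= e / 4.
  apply: (@le_trans _ _ (2 * (d0 * E)^-1)).
    by rewrite ler_wpM2l// expRN_le_inv// mulr_gt0.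
  have {}E3 : 8 <= E * (d0 * e) by rewrite -ler_pdivrMr// mulr_gt0.
  rewrite ler_pdivrMr; last exact: mulr_gt0.
  by clear - E3; lra.
have t3 : 2 * C6 / (g * A ^+ 2) <= e / 2.
  have A0 : 0 < A ^+ 2 by rewrite exprn_gt0// (lt_le_trans ltr01).
  rewrite ler_pdivrMr; last exact: mulr_gt0.
  by have {}eA := lowerA _ _ (mulr_gt0 g0 e0) eA; clear - eA; lra.
by rewrite lee_fin; apply: le_trans (lerD (lerD t1 t2) t3) _; clear; lra.
Qed.
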